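(* Let $M$ be a symmetric space and $N\leq M$ an integral subspace whose topology is induced by $M$, i.e. the inclusion map $\iota\colon N\rightarrow M$ is a topological embedding. Then $N$ is a symmetric subspace of $M$.
   Context: Manifolds are smooth manifolds modelled on Banach spaces. A reflection space is a set $M$ with a multiplication $\mu\colon M\times M\to M$, $(x,y)\mapsto x\cdot y$, such that each $\mu_x:=\mu(x,\cdot)$ is an involutive automorphism of $(M,\mu)$ fixing $x$. A reflection subspace is a subset stable under $\mu$. A symmetric space is a smooth Banach manifold with a smooth multiplication making it a reflection space such that each $x$ is an isolated fixed point of $\mu_x$. An integral subspace of $M$ is a reflection subspace $N\leq M$ endowed with a symmetric space structure (for the restricted multiplication) such that the inclusion $\iota\colon N\to M$ is smooth and for every $c\in N$ the tangent map $T_c\iota\colon T_cN\to T_cM$ is a (closed) topological embedding. A subset $N\subseteq M$ is a submanifold if for each $x\in N$ there are a chart $\varphi\colon U\to V\subseteq E$ of $M$ at $x$ and a closed (not necessarily complemented) subspace $F\subseteq E$ with $\varphi(U\cap N)=V\cap F$. A symmetric subspace of $M$ is a reflection subspace that is a submanifold of $M$. *)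

(* Defs.v *)
From HB Require Import structures.
From mathcomp Require Import all_boot all_order all_algebra.
From mathcomp Require Import all_classical all_reals all_analysis.
Import Order.TTheory GRing.Theory Num.Theory.
Import numFieldNormedType.Exports.

Set Implicit Arguments.
Unset Strict Implicit.
Unset Printing Implicit Defensive.

Local Open Scope classical_set_scope.
Local Open Scope ring_scope.

(** ** Smooth maps between Banach spaces *)

(* The second derivative is that of the map [(x, h) |-> 'd f x h] on [U * E],
   rather than of the operator-valued map [x |-> 'd f x] (the library has no
   normed space of bounded operators).  For a fixed [k] this is slightly weaker
   than being of class C^k in the operator-norm sense, but it is implied by it,
   and it implies the operator-norm class C^(k-1); hence [smooth_on] is the
   usual class C^oo.  [U] is meant to be open; the values of [f] outside [U]
   are irrelevant. *)
Fixpoint Ck_on {R : realType} (k : nat) {E F : normedModType R}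
    (U : set E) (f : E -> F) : Prop :=
  match k with
  | 0 => forall x, U x -> {for x, continuous f}
  | k'.+1 => (forall x, U x -> differentiable f x) /\
             Ck_on k' (U `*` [set: E]) (fun p : E * E => 'd f (p.1) p.2)
  end.

Definition smooth_on {R : realType} {E F : normedModType R}
    (U : set E) (f : E -> F) : Prop := forall k, Ck_on k U f.

Definition topological_embedding {X Y : topologicalType} (f : X -> Y) : Prop :=
  injective f /\
  forall A : set X, open A <-> exists2 B : set Y, open B & f @^-1` B = A.

(** ** Banach manifolds *)

(* A homeomorphism from the open subset [dom] of [T] onto the open subset [cod]
   of [E]; [fwd] and [bwd] take arbitrary values outside [dom] and [cod]. *)
Record chart (R : realType) (T : topologicalType)
    (E : completeNormedModType R) := Chart {
  dom : set T;
  cod : set E;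
  fwd : T -> E;
  bwd : E -> T;
  open_dom : open dom;
  open_cod : open cod;
  fwd_cod : forall x, dom x -> cod (fwd x);
  bwd_dom : forall v, cod v -> dom (bwd v);
  fwdK : forall x, dom x -> bwd (fwd x) = x;
  bwdK : forall v, cod v -> fwd (bwd v) = v;
  fwd_continuous : forall x, dom x -> {for x, continuous fwd};
  bwd_continuous : forall v, cod v -> {for v, continuous bwd}
}.

Definition smooth_transition (R : realType) (T : topologicalType)
    (E F : completeNormedModType R) (phi : chart T E) (psi : chart T F) : Prop :=
  smooth_on (cod phi `&` bwd phi @^-1` dom psi) (fwd psi \o bwd phi).

(* Different charts may take values in different Banach spaces.  The atlas
   comes with a preferred chart around each point. *)
Record banachManifold (R : realType) := BanachManifold {
  points :> topologicalType;
  chart_index : Type;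
  model : chart_index -> completeNormedModType R;
  atlas : forall i, chart points (model i);
  chart_at : points -> chart_index;
  mem_chart_at : forall x, dom (atlas (chart_at x)) x;
  atlas_compatible : forall i j, smooth_transition (atlas i) (atlas j)
}.
Arguments atlas {R} M i : rename.

(* Membership in the maximal atlas. *)
Definition manifold_chart (R : realType) (M : banachManifold R)
    (E : completeNormedModType R) (phi : chart M E) : Prop :=
  forall i, smooth_transition phi (atlas M i) /\ smooth_transition (atlas M i) phi.

Definition smooth_map (R : realType) (M N : banachManifold R)
    (f : M -> N) : Prop :=
  continuous f /\
  forall (i : chart_index M) (j : chart_index N),
    let phi := atlas M i in let psi := atlas N j in
    smooth_on (cod phi `&` (f \o bwd phi) @^-1` dom psi)
              (fwd psi \o f \o bwd phi).

(* Smoothness on the product manifold [M * N], whose atlas consists of the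
   products of the charts of [M] and [N]. *)
Definition smooth_map2 (R : realType) (M N P : banachManifold R)
    (f : M -> N -> P) : Prop :=
  continuous (fun p : M * N => f p.1 p.2) /\
  forall (i : chart_index M) (j : chart_index N) (k : chart_index P),
    let phi := atlas M i in let psi := atlas N j in let chi := atlas P k in
    let f' := fun p : model i * model j => f (bwd phi p.1) (bwd psi p.2) in
    smooth_on ((cod phi `*` cod psi) `&` f' @^-1` dom chi) (fwd chi \o f').

(* T_x M, identified with the model space of the preferred chart at [x]. *)
Definition tangent_space (R : realType) (M : banachManifold R) (x : M) :
  completeNormedModType R := model (chart_at x).

Definition tangent_map (R : realType) (M N : banachManifold R) (f : M -> N)
    (x : M) : tangent_space x -> tangent_space (f x) :=
  let phi := atlas M (chart_at x) in
  let psi := atlas N (chart_at (f x)) in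
  'd (fwd psi \o f \o bwd phi) (fwd phi x).

Definition closed_subspace (R : realType) (E : completeNormedModType R)
    (F : set E) : Prop :=
  [/\ F 0, forall u v, F u -> F v -> F (u + v),
      forall (a : R) u, F u -> F (a *: u) & closed F].

Definition submanifold (R : realType) (M : banachManifold R)
    (N : set M) : Prop :=
  forall x, N x ->
  exists (E : completeNormedModType R) (phi : chart M E) (F : set E),
    [/\ manifold_chart phi, dom phi x, closed_subspace F &
        fwd phi @` (dom phi `&` N) = cod phi `&` F].

(** ** Symmetric spaces *)

Definition reflection_space (T : Type) (mu : T -> T -> T) : Prop :=
  forall x, [/\ involutive (mu x), {morph mu x : y z / mu y z} & mu x x = x].

Definition reflection_subspace (T : Type) (mu : T -> T -> T)
    (N : set T) : Prop :=
  forall x y, N x -> N y -> N (mu x y).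

Record symmetricSpace (R : realType) := SymmetricSpace {
  manifold :> banachManifold R;
  refl : manifold -> manifold -> manifold;
  refl_space : reflection_space refl;
  refl_smooth : smooth_map2 refl;
  refl_isolated : forall x, isolated [set y | refl x y = y] x
}.
Arguments refl {R} M x y : rename.

(* An integral subspace structure on the subset [N] of [M].  The symmetric
   space structure on [N] is carried by a separate type [isub_space] that
   [isub_incl] identifies with [N]: its topology is part of the structure and
   in general differs from the one induced by [M]. *)
Record integralSubspace (R : realType) (M : symmetricSpace R) (N : set M) :=
    IntegralSubspace {
  isub_reflection : reflection_subspace (refl M) N;
  isub_space :> symmetricSpace R;
  isub_incl : isub_space -> M;
  isub_inj : injective isub_incl;
  isub_range : range isub_incl = N;
  isub_mul : forall x y,
    isub_incl (refl isub_space x y) = refl M (isub_incl x) (isub_incl y);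
  isub_smooth : smooth_map isub_incl;
  isub_tangent : forall c : isub_space,
    topological_embedding (tangent_map isub_incl (x := c)) /\
    closed (range (tangent_map isub_incl (x := c)))
}.
Arguments isub_incl {R M N} S x : rename.

Definition symmetric_subspace (R : realType) (M : symmetricSpace R)
    (N : set M) : Prop :=
  reflection_subspace (refl M) N /\ submanifold N.

(* Main.v *)
Require Import Defs.
From HB Require Import structures.
From mathcomp Require Import all_boot all_order all_algebra.
From mathcomp Require Import all_classical all_reals all_analysis.
From mathcomp Require Import lra ring.
Import Order.TTheory GRing.Theory Num.Theory.
Import numFieldNormedType.Exports.

Set Implicit Arguments.
Unset Strict Implicit.
Unset Printing Implicit Defensive.

Local Open Scope classical_set_scope.
Local Open Scope ring_scope.

(* Koenigs linearization replaces geodesics.  In a chart centred at [c], the map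
   [s v = v . c] fixes [0] and its derivative there is twice the identity: the
   derivative of [y |-> c . y] is [-1] because its fixed point [c] is isolated,
   and [x . x = x] gives the other partial derivative.  The iterates
   [s^n (2^-n v)] converge to a map [e] with [e v = s (e (v / 2))] and
   [e v = v + O(|v|^2)].  It is smooth because the tangent map of [s] has the
   same properties as [s] (and its Koenigs map is the tangent map of [e]), so by
   the inverse function theorem it is a local diffeomorphism.  As [e] is
   determined by these properties, it is natural: [i (e_N w) = e_M (T_c i w)] for
   the inclusion [i] of [N].  Hence, the topology of [N] being induced by [M], the
   inverse of [e_M] is a chart of [M] that maps [N] onto the image of [T_c i]. *)

(** * Differentials and the mean value inequality *)

(** The chart must be built from [M] alone and straighten the inclusion by naturality. Geometrically
    [e] is the exponential map at [c]: reflecting [c] in the midpoint of a geodesic that starts at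
    [c] gives its endpoint, which is [e v = s (e (v / 2))]. The ratio [3 / 4] that recurs below is
    [3 / 2 ^ 2]. Near the origin [s] is Lipschitz with constant [3], a little more than its
    derivative [2], while halving the argument divides a quadratic error by [4]. This one comparison
    gives both the convergence of the iterates and the uniqueness behind naturality. Passing to
    tangent maps only shows that [e] is of class C^k on a ball that may shrink with [k]; the
    functional equation then enlarges it to a radius independent of [k]. Derivatives are treated as
    maps of point and vector jointly. Estimates are proved for short vectors and extended to all
    vectors by homogeneity. *)

Section Distances.
Context {R : realType} {V W : normedModType R}.
Implicit Types (f : V -> W) (x : V).

Lemma nbhs_distP x (P : set V) :
  nbhs x P <-> exists2 d : R, 0 < d & forall y, `|y - x| < d -> P y.
Proof.
split=> [/nbhs_ballP[d d0 dP]|[d d0 dP]].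
  by exists d => // y yx; apply: dP; rewrite -ball_normE /= distrC.
by apply/nbhs_ballP; exists d => // y; rewrite -ball_normE /= distrC; exact: dP.
Qed.

Lemma open_dist x (U : set V) : open U -> U x ->
  exists2 d : R, 0 < d & forall y, `|y - x| < d -> U y.
Proof. by move=> Uo Ux; apply/nbhs_distP; exact: open_nbhs_nbhs. Qed.

Lemma continuous_distP f x : {for x, continuous f} <->
  forall e : R, 0 < e ->
    exists2 d : R, 0 < d & forall y, `|y - x| < d -> `|f y - f x| < e.
Proof.
split=> [/cvgrPdist_lt fc e e0|fc].
  by have /nbhs_distP[d d0 dP] := fc e e0; exists d => // y /dP /=; rewrite distrC.
apply/cvgrPdist_lt => e e0; have [d d0 dP] := fc e e0.
by apply/nbhs_distP; exists d => // y /dP; rewrite distrC.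
Qed.

Lemma diff_dist f x : differentiable f x -> forall e : R, 0 < e ->
  exists2 d : R, 0 < d &
    forall y, `|y - x| < d -> `|f y - f x - 'd f x (y - x)| <= e * `|y - x|.
Proof.
move=> /diff_locallyP[_ /eqaddoP fx] e e0.
have /nbhs_distP[d d0 dP] := fx _ e0; exists d => // y yx.
have := dP (y - x); rewrite subr0 => /(_ yx) /=.
rewrite !fctE /= subrK.
by rewrite opprD addrA.
Qed.

Lemma is_diff_dist f x (L : V -> W) :
    linear L -> continuous L ->
    (forall e : R, 0 < e -> exists2 d : R, 0 < d &
      forall y, `|y - x| < d -> `|f y - f x - L (y - x)| <= e * `|y - x|) ->
  is_diff x f L.
Proof.
move=> Llin Lcont fx.
pose L' : {linear V -> W} := HB.pack L (GRing.isLinear.Build _ _ _ _ L Llin).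
have fL : f \o shift x = cst (f x) + L' +o_ 0 id.
  apply/eqaddoP => e e0; have [d d0 dP] := fx e e0.
  apply/nbhs_distP; exists d => // y; rewrite subr0 => yd.
  have := dP (y + x); rewrite addrK => /(_ yd).
  by rewrite !fctE /= opprD addrA.
have dfL := @diff_unique _ _ _ f L' x Lcont fL.
split; last by rewrite dfL.
by apply/diff_locallyP; rewrite dfL.
Qed.

Lemma linear_le_continuous (L : V -> W) (k : R) :
  linear L -> (forall h, `|L h| <= k * `|h|) -> continuous L.
Proof.
move=> Llin Lk.
pose L' : {linear V -> W} := HB.pack L (GRing.isLinear.Build _ _ _ _ L Llin).
apply/(linear_bounded_continuous L')/linear_boundedP.
exists k; split=> [|m km h]; first exact: num_real.
by rewrite (le_trans (Lk h))// ler_wpM2r// ltW.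
Qed.

Lemma diff_linear f x : linear ('d f x).
Proof. by move=> a u v; rewrite linearP. Qed.

End Distances.

(* The set of times at which the bound holds has a supremum, which belongs to
   it, and cannot be [< 1]. *)
Lemma unit_mean_value_le {R : realType} {W : normedModType R} (g : R -> W)
    (M : R) :
    (forall t, 0 <= t <= 1 -> exists2 l : W, `|l| <= M &
      forall e : R, 0 < e -> exists2 d : R, 0 < d & forall u, `|u - t| < d ->
        `|g u - g t - (u - t) *: l| <= e * `|u - t|) ->
  `|g 1 - g 0| <= M.
Proof.
move=> gd; apply/ler_addgt0Pr => e e0.
(* The slack [e] absorbs the first-order error, so that the slope of [g] around each time is at most
   [M + e]. *)
have {}gd t : 0 <= t <= 1 -> exists2 d : R, 0 < d & forall u, `|u - t| < d ->
    `|g u - g t| <= (M + e) * `|u - t|.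
  move=> /gd[l lM] /(_ _ e0)[d d0 dP]; exists d => // u /dP ut.
  rewrite -(subrK ((u - t) *: l) (g u - g t)) (le_trans (ler_normD _ _))//.
  by rewrite normrZ mulrDl addrC lerD// mulrC ler_wpM2r.
pose S := [set t | 0 <= t <= 1 /\ `|g t - g 0| <= (M + e) * t].
have S0 : S 0 by split; [rewrite lexx ler01 | rewrite subrr normr0 mulr0].
have supS : has_sup S by split; [exists 0 | exists 1 => t [/andP[]]].
have c0 : 0 <= sup S by apply: sup_upper_bound.
have c1 : sup S <= 1 by apply: ge_sup => [|t [/andP[]]]; first by exists 0.
have [d d0 dP] : exists2 d : R, 0 < d & forall u, `|u - sup S| < d ->
    `|g u - g (sup S)| <= (M + e) * `|u - sup S|.
  by apply: gd; rewrite c0.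
have Sc : S (sup S).
  have [t St tc] := sup_adherent d0 supS.
  have tc' : t <= sup S by exact: sup_upper_bound.
  have /dP : `|t - sup S| < d by rewrite ler0_norm ?subr_le0//; lra.
  rewrite ler0_norm ?subr_le0// distrC => gt.
  split; first by rewrite c0.
  rewrite -(subrKA (g t)) (le_trans (ler_normD _ _))//.
  by case: St => _; lra.
have [c1'|c1'] := ltP (sup S) 1; last first.
  have c1E : sup S = 1 by apply/le_anti; rewrite c1.
  by case: Sc => _; rewrite c1E mulr1.
pose u := Num.min 1 (sup S + d / 2).
have uc : sup S < u by rewrite lt_min c1'; lra.
have ud : u <= sup S + d / 2 by rewrite ge_min lexx orbT.
have : S u.
  split; first by rewrite ge_min lexx /= (le_trans c0)// ltW.
  have /dP : `|u - sup S| < d by rewrite gtr0_norm ?subr_gt0//; lra.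
  rewrite gtr0_norm ?subr_gt0// => gu.
  rewrite -(subrKA (g (sup S))) (le_trans (ler_normD _ _))//.
  by case: Sc => _; lra.
by move=> /(sup_upper_bound supS); rewrite leNgt uc.
Qed.

Lemma mean_value_le {R : realType} {V W : normedModType R} (f : V -> W)
    (x y : V) (M : R) :
    (forall t : R, 0 <= t <= 1 -> differentiable f (x + t *: (y - x)) /\
      `|'d f (x + t *: (y - x)) (y - x)| <= M) ->
  `|f y - f x| <= M.
Proof.
move=> fd; pose g (t : R) := f (x + t *: (y - x)).
have -> : f y = g 1 by rewrite /g scale1r addrC subrK.
have -> : f x = g 0 by rewrite /g scale0r addr0.
apply: unit_mean_value_le => t /fd[ft ftM]; exists ('d f (x + t *: (y - x)) (y - x)).
  exact: ftM.
(* Dividing by [|y - x| + 1] instead of [|y - x|] avoids a separate case [x = y]. *)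
move=> e e0; have [] := diff_dist ft (e := e / (`|y - x| + 1)).
  by rewrite divr_gt0// ltr_wpDl.
move=> d d0 dP; exists (d / (`|y - x| + 1)); first by rewrite divr_gt0// ltr_wpDl.
move=> u; rewrite ltr_pdivlMr ?ltr_wpDl// => ut.
have E : x + u *: (y - x) - (x + t *: (y - x)) = (u - t) *: (y - x).
  by rewrite opprD addrACA subrr add0r scalerBl.
have utd : `|u - t| * `|y - x| < d.
  by apply: le_lt_trans ut; rewrite ler_wpM2l// lerDl.
have := dP (x + u *: (y - x)); rewrite E normrZ => /(_ utd).
rewrite linearZ /= => /le_trans; apply.
rewrite (_ : _ * _ = e * `|u - t| * (`|y - x| / (`|y - x| + 1))); last by ring.
by rewrite ler_piMr ?mulr_ge0 ?(ltW e0)// ler_pdivrMr ?ltr_wpDl// mul1r lerDl.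
Qed.

Lemma norm_segment_le {R : realType} {V : normedModType R} (x y z : V) (t : R) :
  0 <= t <= 1 ->
  `|x + t *: (y - x) - z| <= Num.max `|x - z| `|y - z|.
Proof.
move=> /andP[t0 t1]; rewrite (_ : _ - z = (1 - t) *: (x - z) + t *: (y - z)).
  rewrite (le_trans (ler_normD _ _))// !normrZ ger0_norm ?subr_ge0// ger0_norm//.
  set m := Num.max _ _.
  have xm : `|x - z| <= m by rewrite le_max lexx.
  have ym : `|y - z| <= m by rewrite le_max lexx orbT.
  by nra.
rewrite addrAC scalerBl scale1r -[RHS]addrA; congr (_ + _).
by rewrite [RHS]addrC -scalerBr opprB addrA subrK.
Qed.

(** * Calculus of smooth maps *)

Lemma open_setX {S T : topologicalType} (A : set S) (B : set T) :
  open A -> open B -> open (A `*` B).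
Proof.
move=> Ao Bo; rewrite (_ : _ `*` _ = fst @^-1` A `&` snd @^-1` B); last first.
  by apply/seteqP; split => -[].
by apply: openI; apply: open_comp => // p _; [exact: cvg_fst | exact: cvg_snd].
Qed.

Section CkCalculus.
Context {R : realType}.
Implicit Types (E F G : normedModType R).

Lemma Ck_on_sub k E F (U V : set E) (f : E -> F) :
  V `<=` U -> Ck_on k U f -> Ck_on k V f.
Proof.
elim: k E F U V f => [|k IH] E F U V f VU /=; first by move=> fU x /VU /fU.
by case=> fd fC; split=> [x /VU /fd//|]; apply: IH fC => p [/VU].
Qed.

(** [Ck_on] tests [f] as a map of the whole space at the points of a set, never relative to that
    set; hence arbitrary sets [V] will do. *)
Lemma Ck_on_local k E F (U : set E) (f : E -> F) :
  (forall x, U x -> exists2 V : set E, V x & Ck_on k V f) -> Ck_on k U f.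
Proof.
elim: k E F U f => [|k IH] E F U f /=; first by move=> fU x /fU[V Vx]; apply.
move=> fU; split=> [x /fU[V Vx []]|]; first by move=> + _; apply.
by apply: IH => p [/fU[V Vx [_ fC]] _]; exists (V `*` setT).
Qed.

Lemma is_diff_ext E F (U : set E) (f g df : E -> F) x :
  open U -> U x -> (forall y, U y -> f y = g y) ->
  is_diff x f df -> is_diff x g df.
Proof.
move=> Uo Ux fg [fd dfE].
have [r r0 rU] := open_dist Uo Ux.
rewrite -dfE; apply: is_diff_dist; first exact: diff_linear.
  exact: diff_continuous.
move=> e e0; have [d d0 dP] := diff_dist fd e0.
exists (Num.min d r); first by rewrite lt_min d0.
by move=> y; rewrite lt_min => /andP[/dP + /rU /fg <-]; rewrite (fg _ Ux).
Qed.

Lemma Ck_on_ext k E F (U : set E) (f g : E -> F) :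
  open U -> (forall x, U x -> f x = g x) -> Ck_on k U f -> Ck_on k U g.
Proof.
elim: k E F U f g => [|k IH] E F U f g Uo fg /=.
  move=> fC x Ux; have /continuous_distP fx := fC x Ux.
  have [r r0 rU] := open_dist Uo Ux.
  apply/continuous_distP => e /fx[d d0 dP].
  exists (Num.min d r); first by rewrite lt_min d0.
  by move=> y; rewrite lt_min => /andP[/dP + /rU /fg <-]; rewrite (fg _ Ux).
case=> fd fC; have gd x : U x -> is_diff x g ('d f x).
  by move=> Ux; apply: (is_diff_ext Uo Ux fg); apply: differentiableP; exact: fd.
split=> [x /gd[]//|]; apply: IH fC; first by apply: open_setX => //; exact: openT.
by case=> x h [/= /gd /@diff_val ->].
Qed.

Lemma Ck_onS k E F (U : set E) (f : E -> F) : Ck_on k.+1 U f -> Ck_on k U f.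
Proof.
elim: k E F U f => [|k IH] E F U f.
  by case=> fd _ x /fd /differentiable_continuous.
by case=> fd /IH.
Qed.

Lemma Ck_on_cst k E F (U : set E) (c : F) : Ck_on k U (cst c).
Proof.
elim: k E F U c => [|k IH] E F U c /=; first by move=> x _; exact: cvg_cst.
split=> [x _|]; first exact: differentiable_cst.
rewrite (_ : (fun p => _) = cst 0); first exact: IH.
by apply/funext => p; rewrite diff_cst.
Qed.

Lemma is_diff_linear E F (f : E -> F) x : linear f -> continuous f ->
  is_diff x f f.
Proof.
move=> fl fc; apply: is_diff_dist => // e e0; exists 1 => // y _.
pose f' : {linear E -> F} := HB.pack f (GRing.isLinear.Build _ _ _ _ f fl).
by rewrite -[f (y - x)]/(f' (y - x)) linearB subrr normr0 mulr_ge0// ltW.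
Qed.

Lemma Ck_on_linear k E F (U : set E) (f : E -> F) :
  linear f -> continuous f -> Ck_on k U f.
Proof.
elim: k E F U f => [|k IH] E F U f fl fc /=; first by move=> x _; exact: fc.
split=> [x _|]; first by have [] := is_diff_linear x fl fc.
rewrite (_ : (fun p => _) = f \o snd).
  apply: IH => [a u v|p]; first by rewrite /= fl.
  by apply: continuous_comp; [exact: cvg_snd | exact: fc].
by apply/funext => p; have [_ ->] := is_diff_linear p.1 fl fc.
Qed.

Lemma Ck_on_pair k E F G (U : set E) (f : E -> F) (g : E -> G) : open U ->
  Ck_on k U f -> Ck_on k U g -> Ck_on k U (fun x => (f x, g x)).
Proof.
elim: k E F G U f g => [|k IH] E F G U f g Uo /=.
  by move=> fC gC x Ux; apply: cvg_pair; [exact: fC | exact: gC].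
case=> fd fC [gd gC].
have UT : open (U `*` [set: E]) by apply: open_setX => //; exact: openT.
split=> [x Ux|]; first by apply: differentiable_pair; [exact: fd | exact: gd].
apply: Ck_on_ext (IH _ _ _ _ _ _ UT fC gC) => // -[x h] [/= Ux _].
by rewrite diff_pair//=; [exact: fd | exact: gd].
Qed.

(** By the chain rule the derivative of [g \o f] is the derivative map of [g] after
    [(x, h) |-> (f x, 'd f x h)]. This is again a composition, one order lower and between product
    spaces, so the induction ranges over all spaces. *)
Lemma Ck_on_comp k E F G (U : set E) (V : set F) (f : E -> F) (g : F -> G) :
  open U -> open V -> (forall x, U x -> V (f x)) ->
  Ck_on k U f -> Ck_on k V g -> Ck_on k U (g \o f).
Proof.
elim: k E F G U V f g => [|k IH] E F G U V f g Uo Vo UV fC gC.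
  by move=> x Ux; apply: continuous_comp; [exact: fC | exact/gC/UV].
have [fd dfC] := fC; have [gd dgC] := gC.
have UT : open (U `*` [set: E]) by apply: open_setX => //; exact: openT.
have VT : open (V `*` [set: F]) by apply: open_setX => //; exact: openT.
split=> [x Ux|]; first by apply: differentiable_comp; [exact: fd | exact/gd/UV].
have f1C : Ck_on k (U `*` [set: E]) (fun p : E * E => f p.1).
  apply: (IH _ _ _ _ U fst f) => //; [by move=> p [] | | exact: Ck_onS].
  by apply: Ck_on_linear => [//|p]; exact: cvg_fst.
have sub p : (U `*` [set: E]) p -> (V `*` [set: F]) (f p.1, 'd f (p.1) p.2).
  by move=> [/UV].
apply: (Ck_on_ext UT _ (IH _ _ _ _ _ _ _ UT VT sub (Ck_on_pair UT f1C dfC) dgC)).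
by case=> x h [/= Ux _]; rewrite (diff_comp (fd _ Ux) (gd _ (UV _ Ux))).
Qed.

Lemma Ck_on_add k E F (U : set E) (f g : E -> F) : open U ->
  Ck_on k U f -> Ck_on k U g -> Ck_on k U (fun x => f x + g x).
Proof.
move=> Uo fC gC.
apply: (@Ck_on_comp k _ _ _ U setT (fun x => (f x, g x)) (fun p => p.1 + p.2)) => //.
- exact: openT.
- exact: Ck_on_pair.
apply: Ck_on_linear => [a u v|p]; last exact: add_continuous.
by rewrite /= scalerDr addrACA.
Qed.

Lemma smooth_on_comp E F G (U : set E) (V : set F) (f : E -> F) (g : F -> G) :
  open U -> open V -> (forall x, U x -> V (f x)) ->
  smooth_on U f -> smooth_on V g -> smooth_on U (g \o f).
Proof. by move=> Uo Vo UV fC gC k; exact: Ck_on_comp (fC k) (gC k). Qed.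

Lemma smooth_on_sub E F (U V : set E) (f : E -> F) :
  V `<=` U -> smooth_on U f -> smooth_on V f.
Proof. by move=> VU fC k; exact: Ck_on_sub (fC k). Qed.

Lemma smooth_on_pair E F G (U : set E) (f : E -> F) (g : E -> G) : open U ->
  smooth_on U f -> smooth_on U g -> smooth_on U (fun x => (f x, g x)).
Proof. by move=> Uo fC gC k; exact: Ck_on_pair. Qed.

Lemma smooth_on_cst E F (U : set E) (c : F) : smooth_on U (cst c).
Proof. by move=> k; exact: Ck_on_cst. Qed.

Lemma smooth_on_linear E F (U : set E) (f : E -> F) :
  linear f -> continuous f -> smooth_on U f.
Proof. by move=> fl fc k; exact: Ck_on_linear. Qed.

Lemma smooth_on_id E (U : set E) : smooth_on U (@id E).
Proof. by apply: smooth_on_linear => // x; exact: cvg_id. Qed.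

Lemma smooth_on_add E F (U : set E) (f g : E -> F) : open U ->
  smooth_on U f -> smooth_on U g -> smooth_on U (fun x => f x + g x).
Proof. by move=> Uo fC gC k; exact: Ck_on_add. Qed.

Lemma smooth_on_differentiable E F (U : set E) (f : E -> F) x :
  smooth_on U f -> U x -> differentiable f x.
Proof. by move=> fC Ux; have [fd _] := fC 1%N; exact: fd. Qed.

Lemma smooth_on_continuous E F (U : set E) (f : E -> F) x :
  smooth_on U f -> U x -> {for x, continuous f}.
Proof. by move=> fC Ux; exact: (fC 0%N). Qed.

Lemma smooth_on_diff E F (U : set E) (f : E -> F) :
  smooth_on U f -> smooth_on (U `*` setT) (fun p : E * E => 'd f (p.1) p.2).
Proof. by move=> fC k; have [] := fC k.+1. Qed.

(* The proof bounds the mixed derivative near [(x0, 0; 0, 0)], where it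
   vanishes, and uses homogeneity in the two increments. *)
Lemma smooth_on_quadratic E F (U : set E) (f : E -> F) x0 :
  open U -> U x0 -> smooth_on U f ->
  exists r C : R, [/\ 0 < r, 0 <= C, forall x, `|x - x0| < r -> U x &
    forall x y, `|x - x0| < r -> `|y - x0| < r ->
      `|f x - f y - 'd f x0 (x - y)|
        <= C * Num.max `|x - x0| `|y - x0| * `|x - y|].
Proof.
move=> Uo Ux0 fC.
have [fd [dfd ddfC]] := fC 2%N.
pose A (p : E * E) := 'd f (p.1) p.2.
have /continuous_distP/(_ 1 ltr01)[d d0 dP] :
    {for ((x0, 0), (0, 0)), continuous (fun q : (E * E) * (E * E) => 'd A (q.1) q.2)}.
  exact: ddfC.
have [r0 r00 r0U] := open_dist Uo Ux0.
pose r := Num.min d r0.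
have r_gt0 : 0 < r by rewrite lt_min d0.
have rU x : `|x - x0| < r -> U x.
  by rewrite lt_min => /andP[_ /r0U].
(* A bound [1] on vectors of norm [d / 2] rescales to the factor [2 / d]. It enters once for the
   increment [x - x0] and once for [h], whence [C = c * c]. *)
pose c := 2 / d.
have c_gt0 : 0 < c by rewrite divr_gt0.
pose C := c * c.
have A1 x h : `|x - x0| < r -> `|h| < d -> `|x - x0| < d ->
    `|A (x, h) - A (x0, h)| <= c * `|x - x0|.
  move=> xr hd xd.
  have [->|xx0] := eqVneq x x0; first by rewrite !subrr !normr0 mulr0.
  have n0 : 0 < `|x - x0| by rewrite normr_gt0 subr_eq0.
  apply: mean_value_le => t /andP[t0 t1] /=.
  have -> : (x0, h) + t *: ((x, h) - (x0, h)) = (x0 + t *: (x - x0), h).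
    by congr pair; rewrite /= subrr scaler0 addr0.
  have -> : (x, h) - (x0, h) = (x - x0, 0) :> E * E.
    by congr pair; rewrite /= subrr.
  have txr : `|x0 + t *: (x - x0) - x0| < r.
    apply: le_lt_trans xr; rewrite addrC addKr normrZ ger0_norm//.
    by rewrite ler_piMl.
  split; first by apply: dfd; split => //; exact: rU.
  pose b := (d / 2) / `|x - x0|.
  have b0 : 0 < b by rewrite !divr_gt0.
  have /dP : `|((x0 + t *: (x - x0), h), (b *: (x - x0), 0))
               - ((x0, 0), (0, 0)) : (E * E) * (E * E)| < d.
    rewrite !prod_normE /= !subr0 !gt_max normr0 d0 hd !andbT.
    rewrite (lt_le_trans txr) ?ge_min ?lexx//=.
    by rewrite normrZ gtr0_norm// divfK ?gt_eqF//; lra.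
  rewrite /= (_ : 'd A (x0, 0) (0, 0) = 0) ?subr0; last exact: linear0.
  have -> : (b *: (x - x0), 0) = b *: (x - x0, 0) :> E * E.
    by congr pair; rewrite /= scaler0.
  rewrite linearZ normrZ gtr0_norm// -ltr_pdivlMl// => /ltW /le_trans; apply.
  by rewrite [leLHS](_ : _ = c * `|x - x0|)// /b /c; field; rewrite !gt_eqF.
have A2 x h : `|x - x0| < r -> `|A (x, h) - A (x0, h)| <= C * `|x - x0| * `|h|.
  move=> xr.
  have [->|h0] := eqVneq h 0.
    by rewrite !(_ : forall z, A (z, 0) = 0) ?subrr ?normr0 ?mulr0// => z; exact: linear0.
  have n0 : 0 < `|h| by rewrite normr_gt0.
  pose b := (d / 2) / `|h|.
  have b0 : 0 < b by rewrite !divr_gt0.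
  have : `|A (x, b *: h) - A (x0, b *: h)| <= c * `|x - x0|.
    apply: A1 => //; last by apply: lt_le_trans xr _; rewrite ge_min lexx.
    by rewrite normrZ gtr0_norm// divfK ?gt_eqF//; lra.
  have AZ z : A (z, b *: h) = b *: A (z, h) by exact: linearZ.
  rewrite !AZ -scalerBr normrZ gtr0_norm// -ler_pdivlMl// => /le_trans.
  apply; rewrite [leLHS](_ : _ = C * `|x - x0| * `|h|)// /b /C /c.
  by field; rewrite !gt_eqF.
exists r, C; split => //; first by rewrite mulr_ge0 ?ltW.
move=> x y xr yr.
have L0 u : is_diff u ('d f x0) ('d f x0).
  by apply: is_diff_linear; [exact: diff_linear|exact/diff_continuous/fd].
pose g z := f z - 'd f x0 z.
have -> : f x - f y - 'd f x0 (x - y) = g x - g y.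
  by rewrite /g linearB !opprB (addrC ('d f x0 y)) addrACA (addrC (- f y)).
apply: mean_value_le => t /andP[t0 t1].
have zr : `|y + t *: (x - y) - x0| <= Num.max `|x - x0| `|y - x0|.
  by rewrite maxC norm_segment_le// t0.
set z := y + _ in zr *.
have zr' : `|z - x0| < r by apply: le_lt_trans zr _; rewrite gt_max xr.
have fz : differentiable f z by apply: fd; exact: rU.
have [gz gzE] : is_diff z g (fun h => 'd f z h - 'd f x0 h).
  exact: (is_diffB (differentiableP fz) (L0 z)).
split => //; rewrite gzE /= (le_trans (A2 _ _ zr'))// ler_wpM2r//.
by rewrite ler_wpM2l// mulr_ge0 ?ltW.
Qed.

End CkCalculus.

(** * Completeness and geometric convergence *)

(* The library declares the product pointed, but not jointly with its
   topology, as needed to state its completeness. *)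
HB.instance Definition _ (R : realType) (U V : completeNormedModType R) :=
  Pointed.on (U * V)%type.

(** Tangent maps act on [E * E], and their Koenigs limits exist only if this product is again a
    Banach space. *)
Lemma prod_complete {R : realType} (U V : completeNormedModType R)
  (F : set_system (U * V)) : ProperFilter F -> cauchy F -> cvg F.
Proof.
move=> FF /cauchyP cF.
have c1 : cvg (fst @ F).
  apply: cauchy_cvg; apply/cauchyP => e /cF[p Fp].
  exists p.1; suff : F (fst @^-1` ball p.1 e) by [].
  by apply: filterS Fp => -[x y] [].
have c2 : cvg (snd @ F).
  apply: cauchy_cvg; apply/cauchyP => e /cF[p Fp].
  exists p.2; suff : F (snd @^-1` ball p.2 e) by [].
  by apply: filterS Fp => -[x y] [].
apply/cvg_ex; exists (lim (fst @ F), lim (snd @ F)).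
have c12 := cvg_pair c1 c2 => A /c12 FA.
suff : F ((fun p => (p.1, p.2)) @^-1` A) by apply: filterS => -[].
exact: FA.
Qed.

HB.instance Definition _ (R : realType) (U V : completeNormedModType R) :=
  Uniform_isComplete.Build (U * V)%type (@prod_complete R U V).


Section GeometricLimits.
Context {R : realType}.

Lemma le_geometric0 (x K : R) : (forall n, x <= K * (3 / 4) ^+ n) -> x <= 0.
Proof.
move=> xK; have cg : geometric K (3 / 4) @ \oo --> (0 : R).
  by apply: cvg_geometric; rewrite ger0_norm; lra.
rewrite -(cvg_lim _ cg)//; apply: limr_ge; first exact: cvgP cg.
by apply: nearW => n; exact: xK.
Qed.

Lemma geometric_cvg {V : completeNormedModType R} (u : nat -> V) (a : R) :
    (forall n k, `|u (n + k)%N - u n| <= a * (3 / 4) ^+ n) ->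
  u n @[n --> \oo] --> lim (u n @[n --> \oo]) /\
  forall n, `|lim (u n @[n --> \oo]) - u n| <= a * (3 / 4) ^+ n.
Proof.
move=> ua.
have a0 : 0 <= a by have := ua 0%N 0%N; rewrite expr0 mulr1; apply: le_trans.
have cg : geometric a (3 / 4) @ \oo --> (0 : R).
  by apply: cvg_geometric; rewrite ger0_norm; lra.
have cu : cvg (u n @[n --> \oo]).
  apply: cauchy_cvg; apply/cauchyP => e e0.
  have /cvgrPdist_lt/(_ e e0)[N _ NP] := cg.
  exists (u N); exists N => // n /= Nn; rewrite -ball_normE /= distrC.
  rewrite -(subnKC Nn) (le_lt_trans (ua _ _))//.
  have := NP N (leqnn N); rewrite /= sub0r normrN ger0_norm//.
  by rewrite mulr_ge0// exprn_ge0//; lra.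
split => // n; apply/ler_addgt0Pr => e e0.
have /cvgrPdist_lt/(_ e e0)[N _ NP] := cu.
have /ltW := NP (n + N)%N (leq_addl _ _) => /= dN.
by rewrite -(subrKA (u (n + N)%N)) (le_trans (ler_normD _ _))// addrC lerD.
Qed.

(* The increments of [f - f_ n] are controlled by the mean value inequality for
   [f_ (n + k) - f_ n]. *)
Lemma is_diff_limit {V : normedModType R} {W : completeNormedModType R}
    (f_ : nat -> V -> W) (f : V -> W) (r a : R) :
    (forall n v, `|v| < r -> differentiable (f_ n) v) ->
    (forall v, `|v| < r -> f_ n v @[n --> \oo] --> f v) ->
    (forall n k v h, `|v| < r ->
      `|'d (f_ (n + k)%N) v h - 'd (f_ n) v h| <= a * `|h| * (3 / 4) ^+ n) ->
  forall v, `|v| < r -> is_diff v f (fun h => lim ('d (f_ n) v h @[n --> \oo])).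
Proof.
move=> fd fl fa v vr.
pose g v h := lim ('d (f_ n) v h @[n --> \oo]).
have [gl ga] : (forall w h, `|w| < r -> 'd (f_ n) w h @[n --> \oo] --> g w h) /\
    (forall w h n, `|w| < r -> `|g w h - 'd (f_ n) w h| <= a * `|h| * (3 / 4) ^+ n).
  split=> [w h wr|w h n wr];
    by have [] := geometric_cvg (fun n k => fa n k w h wr).
have a_ge0 (h : V) : 0 <= a * `|h|.
  have := fa 0%N 0%N v h vr; rewrite expr0 mulr1; exact: le_trans.
have g_lin : linear (g v).
  move=> b h k; apply: cvg_lim => //.
  rewrite (_ : (fun n => _) = (fun n => b *: 'd (f_ n) v h + 'd (f_ n) v k)).
    by apply: cvgD; [apply: cvgZr; exact: gl | exact: gl].
  by apply/funext => n; rewrite linearP.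
have incr n x y : `|x| < r -> `|y| < r ->
    `|(f y - f x) - (f_ n y - f_ n x)| <= a * `|y - x| * (3 / 4) ^+ n.
  move=> xr yr; have cl : (f_ (n + k)%N y - f_ (n + k)%N x) - (f_ n y - f_ n x)
      @[k --> \oo] --> (f y - f x) - (f_ n y - f_ n x).
    apply: cvgB; last exact: cvg_cst.
    have sh (z : V) : `|z| < r -> f_ (n + k)%N z @[k --> \oo] --> f z.
      move=> zr; rewrite (_ : (fun k => _) = (fun k => f_ (k + n)%N z)).
        by rewrite (cvg_shiftn n (fun k => f_ k z)); exact: fl.
      by apply/funext => k; rewrite addnC.
    by apply: cvgB; exact: sh.
  have /cvg_norm := cl => cln.
  rewrite -(cvg_lim _ cln)//; apply: limr_le; first exact: cvgP cln.
  apply: nearW => k.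
  pose q z := f_ (n + k)%N z - f_ n z.
  have -> : (f_ (n + k)%N y - f_ (n + k)%N x) - (f_ n y - f_ n x) = q y - q x.
    by rewrite /q !opprB (addrC (f_ n x)) addrACA (addrC (f_ n x)).
  apply: mean_value_le => t /andP[t0 t1].
  have zr : `|x + t *: (y - x)| < r.
    rewrite -[_ + _]subr0 (le_lt_trans (norm_segment_le _ _ 0 _)) ?t0//.
    by rewrite !subr0 gt_max xr.
  have [dq dqE] := is_diffB (differentiableP (fd (n + k)%N _ zr))
                            (differentiableP (fd n _ zr)).
  by split => //; rewrite dqE; exact: fa.
apply: is_diff_dist => //.
  have /linear_lipschitz[k k0 fk] : continuous ('d (f_ 0%N) v).
    exact/diff_continuous/fd.
  apply: (@linear_le_continuous _ _ _ _ (k + a)) => // h.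
  rewrite -/(g v h) -(subrK ('d (f_ 0%N) v h) (g v h)) (le_trans (ler_normD _ _))//.
  have := ga v h 0%N vr; rewrite expr0 mulr1 => gh.
  by rewrite mulrDl [leRHS]addrC; exact: lerD.
move=> e e0.
(* One third each for the passage from [f] to [f_ N], for the first-order error of [f_ N], and for
   the passage from the derivative of [f_ N] to its limit. *)
have e3 : 0 < e / 3 by rewrite divr_gt0.
have cg : geometric a (3 / 4) @ \oo --> (0 : R).
  by apply: cvg_geometric; rewrite ger0_norm; lra.
have /cvgrPdist_lt/(_ _ e3)[N _ /(_ N (leqnn N)) /=] := cg.
rewrite sub0r normrN => /(le_lt_trans (ler_norm _)) aN.
have aNh (h : V) : a * `|h| * (3 / 4) ^+ N <= e / 3 * `|h|.
  by rewrite mulrAC ler_wpM2r// ltW.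
have [d d0 dP] := diff_dist (fd N _ vr) e3.
exists (Num.min d (r - `|v|)); first by rewrite lt_min d0 subr_gt0.
move=> y; rewrite lt_min => /andP[yd yr].
have {}yr : `|y| < r.
  by have := ler_normD (y - v) v; rewrite subrK; lra.
have := incr N _ _ vr yr; have := dP _ yd; have := ga v (y - v) N vr.
have := aNh (y - v).
set A := 'd _ _ _; set G := g v _; set fy := f y; set fv := f v.
set fy' := f_ N y; set fv' := f_ N v => h1 h2 h3 h4.
rewrite (_ : fy - fv - G = ((fy - fv) - (fy' - fv')) + ((fy' - fv' - A) + (A - G))).
  rewrite (le_trans (ler_normD _ _))//.
  have := ler_normD (fy' - fv' - A) (A - G); rewrite (distrC A G).
  by have := normr_ge0 (y - v); lra.
by rewrite !subrKA.
Qed.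

End GeometricLimits.

(** * Koenigs maps *)

Lemma open_norm_lt {R : realType} (V : normedModType R) (r : R) :
  open [set v : V | `|v| < r].
Proof.
rewrite openE => v vr; apply/nbhs_distP; exists (r - `|v|); first by rewrite subr_gt0.
by move=> y yv; have := ler_normD (y - v) v; rewrite subrK /=; lra.
Qed.

Definition tangent {R : realType} {E F : normedModType R} (f : E -> F)
  (p : E * E) : F * F := (f p.1, 'd f (p.1) p.2).

Section Tangent.
Context {R : realType} {E F : normedModType R}.
Implicit Types (f : E -> F) (U : set E).

Lemma smooth_on_tangent U f : open U -> smooth_on U f ->
  smooth_on (U `*` [set: E]) (tangent f).
Proof.
move=> Uo fC; have UT : open (U `*` [set: E]) by apply: open_setX => //; exact: openT.
apply: smooth_on_pair => //; last exact: smooth_on_diff.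
apply: (@smooth_on_comp _ _ _ _ _ U fst f) => //; first by move=> p [].
by apply: smooth_on_linear => [//|p]; exact: cvg_fst.
Qed.

Lemma diff_diff_snd U f x z k : smooth_on U f -> U x ->
  'd (fun p : E * E => 'd f (p.1) p.2) (x, z) (0, k) = 'd f x k.
Proof.
move=> fC Ux; set A := fun p => _.
have dA : differentiable A (x, z).
  by apply: (smooth_on_differentiable (smooth_on_diff fC)).
have di : is_diff z (fun k : E => (x, k)) (fun k => (0, k)).
  exact: (is_diff_pair (is_diff_cst x z) (is_diff_id z)).
have [_ /(congr1 (@^~ k)) /= <-] := is_diff_comp di (differentiableP dA).
have [_] := is_diff_linear z (@diff_linear _ _ _ f x)
  (diff_continuous (smooth_on_differentiable fC Ux)).
by move=> /(congr1 (@^~ k)).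
Qed.

Lemma diff_diff_fst0 U f x h : smooth_on U f -> U x ->
  'd (fun p : E * E => 'd f (p.1) p.2) (x, 0) (h, 0) = 0.
Proof.
move=> fC Ux; set A := fun p => _.
have dA : differentiable A (x, 0).
  by apply: (smooth_on_differentiable (smooth_on_diff fC)).
have di : is_diff x (fun y : E => (y, 0 : E)) (fun h => (h, 0)).
  exact: (is_diff_pair (is_diff_id x) (is_diff_cst 0 x)).
have [_] := is_diff_comp di (differentiableP dA).
have -> : A \o (fun y => (y, 0)) = cst 0.
  by apply/funext => y; rewrite /A /= linear0.
by rewrite diff_cst => /(congr1 (@^~ h)).
Qed.

End Tangent.

Section Koenigs.
Context {R : realType}.

Definition doubling {E : normedModType R} (U : set E) (s : E -> E) :=
  [/\ open U, U 0, smooth_on U s, s 0 = 0 & forall h, 'd s 0 h = 2 *: h].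

(** At the zero vector the second derivative of [s] contributes nothing, because ['d s] vanishes on
    the zero section; in the vector direction ['d s 0] is linear, hence its own derivative. Both
    components of the derivative are therefore those of ['d s 0]. *)
Lemma doubling_tangent {E : normedModType R} (U : set E) (s : E -> E) :
  doubling U s -> doubling (U `*` setT) (tangent s).
Proof.
move=> [Uo U0 sC s0 ds]; split.
- by apply: open_setX => //; exact: openT.
- by [].
- exact: smooth_on_tangent.
- by rewrite /tangent /= s0 linear0.
move=> [h k]; rewrite /tangent.
have d1 : differentiable (fun p : E * E => s p.1) 0.
  apply: (smooth_on_differentiable (U := U `*` setT)) => //.
  apply: (@smooth_on_comp _ _ _ _ _ U fst s) => //.
  - by apply: open_setX => //; exact: openT.
  - by move=> p [].
  - by apply: smooth_on_linear => [//|p]; exact: cvg_fst.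
have d2 := smooth_on_differentiable (smooth_on_diff sC) (x := (0, 0)) (conj U0 I).
rewrite diff_pair//=; congr pair.
  have dfst : is_diff (0 : E * E) fst fst.
    by apply: is_diff_linear => [//|p]; exact: cvg_fst.
  have ds0 : is_diff ((0 : E * E).1) s ('d s 0).
    exact/differentiableP/(smooth_on_differentiable sC).
  by have [_ ->] := is_diff_comp dfst ds0; rewrite /= ds.
rewrite (_ : (h, k) = (h, 0) + (0, k)); last by congr pair; rewrite /= ?addr0 ?add0r.
rewrite linearD; etransitivity.
  exact: (congr2 +%R (diff_diff_fst0 h sC U0) (diff_diff_snd 0 k sC U0)).
by rewrite ds /= !add0r.
Qed.

(** This is [s^n (2^-n v)]. With one [s] outermost and one halving innermost, the recursion has the
    functional equation of the Koenigs map as its limit. *)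
Fixpoint koenigs_iter {E : normedModType R} (s : E -> E) (n : nat) (v : E) : E :=
  if n is n'.+1 then s (koenigs_iter s n' (2^-1 *: v)) else v.

Definition koenigs {E : completeNormedModType R} (s : E -> E) (v : E) : E :=
  lim (koenigs_iter s n v @[n --> \oo]).

(** [s] is controlled on the ball of radius [r0]; the smaller radius [r] is such that iterates
    starting from [v] stay in that ball, being within [C * |v| ^+ 2] of [v]. *)
Definition koenigs_bounds {E : normedModType R} (s : E -> E) (r0 r C : R) :=
  [/\ 0 < r, 0 <= C, forall v : E, `|v| < r -> `|v| + C * `|v| ^+ 2 < r0,
      forall x, `|x| < r0 -> `|s x - 2 *: x| <= C * `|x| ^+ 2 &
      forall x y, `|x| < r0 -> `|y| < r0 -> `|s x - s y| <= 3 * `|x - y|].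

Lemma doubling_bounds {E : normedModType R} (U : set E) (s : E -> E) :
  doubling U s ->
  exists r0 r C, koenigs_bounds s r0 r C /\ forall x, `|x| < r0 -> U x.
Proof.
move=> [Uo U0 sC s0 ds].
have [r1 [C [r1_gt0 C0 r1U sq]]] := smooth_on_quadratic Uo U0 sC.
(* [C * |x| <= 1] on this ball bounds the quadratic error by [|x - y|], whence the Lipschitz
   constant [3 = 2 + 1]. It also gives [|v| + C * |v| ^+ 2 <= 2 * |v|], whence the radius [r0 / 2]
   below. *)
pose r0 := Num.min r1 (C + 1)^-1.
have C1 : 0 < C + 1 by lra.
have r00 : 0 < r0 by rewrite lt_min r1_gt0 invr_gt0.
have r0r1 x : x < r0 -> x < r1 by rewrite lt_min => /andP[].
have r0C x : x < r0 -> C * x <= 1.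
  rewrite lt_min => /andP[_]; rewrite -[_^-1]mul1r ltr_pdivlMr// => /ltW.
  have [x0|x0] := leP 0 x; first by lra.
  by move=> _; nra.
exists r0, (r0 / 2), C; split; last by move=> x /r0r1 xr; apply: r1U; rewrite subr0.
split => //; first by rewrite divr_gt0.
- move=> v vr; have := r0C `|v|; have := normr_ge0 v.
  by have -> : `|v| < r0 by [lra]; rewrite expr2; nra.
- move=> x /r0r1 xr; have := sq x 0; rewrite s0 ds !subr0 normr0 => /(_ xr r1_gt0).
  by rewrite max_l ?normr_ge0// -mulrA -expr2.
move=> x y xr yr.
have := sq x y; rewrite ds !subr0 => /(_ (r0r1 _ xr) (r0r1 _ yr)) sxy.
rewrite -(subrK (2 *: (x - y)) (s x - s y)) (le_trans (ler_normD _ _))//.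
rewrite normrZ [`|2|]ger0_norm//.
have : C * Num.max `|x| `|y| <= 1 by apply: r0C; rewrite gt_max xr.
by have := normr_ge0 (x - y); nra.
Qed.

Section Bounds.
Context {E : completeNormedModType R} (s : E -> E) (r0 r C : R).
Hypothesis sb : koenigs_bounds s r0 r C.

Let half_lt (v : E) : `|v| < r -> `|2^-1 *: v| < r.
Proof. by rewrite normrZ ger0_norm//; have := normr_ge0 v; lra. Qed.

Let half_sq (v : E) : `|2^-1 *: v| ^+ 2 = `|v| ^+ 2 / 4.
Proof. by rewrite normrZ ger0_norm// exprMn; field. Qed.

(** Successive iterates differ by at most [C / 4 * (3 / 4) ^+ n * |v| ^+ 2]: the outer [s] costs a
    factor [3] and halving [v] gains a factor [4]. Since [1 / 4 = 1 - 3 / 4], these bounds telescope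
    to the difference of powers. *)
Lemma koenigs_iter_diff n k v : `|v| < r ->
  `|koenigs_iter s (n + k) v - koenigs_iter s n v|
    <= C * `|v| ^+ 2 * ((3 / 4) ^+ n - (3 / 4) ^+ (n + k)).
Proof.
have [r_gt0 C0 vr0 s2 s3] := sb.
(* The first bound keeps the iterates in the ball where [s] is Lipschitz, which the second bound
   needs; hence the joint induction. *)
pose P n := forall v, `|v| < r ->
  `|koenigs_iter s n v - v| <= C * `|v| ^+ 2 * (1 - (3 / 4) ^+ n) /\
  `|koenigs_iter s n.+1 v - koenigs_iter s n v| <= C / 4 * (3 / 4) ^+ n * `|v| ^+ 2.
have small m w : P m -> `|w| < r -> `|koenigs_iter s m w| < r0.
  move=> Pm wr; have [+ _] := Pm _ wr => mw.
  rewrite -(subrK w (koenigs_iter s m w)) (le_lt_trans (ler_normD _ _))//.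
  apply: le_lt_trans (vr0 _ wr); rewrite addrC lerD2l (le_trans mw)//.
  by rewrite ler_piMr ?mulr_ge0 ?exprn_ge0// lerBlDr lerDl exprn_ge0.
have PS m w : P m -> `|w| < r ->
    `|koenigs_iter s m.+1 w - w| <= C * `|w| ^+ 2 * (1 - (3 / 4) ^+ m.+1).
  move=> Pm wr; have [h1 h2] := Pm _ wr.
  rewrite -(subrKA (koenigs_iter s m w)) (le_trans (ler_normD _ _))//.
  by rewrite (exprS (3 / 4)); lra.
have Pn m : P m.
  elim: m => [|m IH] w wr.
    split; first by rewrite /= subrr normr0 expr0 subrr mulr0.
    have := s2 (2^-1 *: w); rewrite scalerA divff// scale1r /=.
    have wr2 : `|2^-1 *: w| < r0.
      have := vr0 _ (half_lt wr); have : 0 <= C * `|2^-1 *: w| ^+ 2.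
        by rewrite mulr_ge0 ?exprn_ge0.
      lra.
    move=> /(_ wr2)/le_trans; apply; rewrite half_sq expr0.
    by lra.
  split; first exact: PS.
  have hw := half_lt wr.
  have [_ h2] := IH _ hw.
  have sm : `|koenigs_iter s m.+1 (2^-1 *: w)| < r0.
    rewrite -(subrK (2^-1 *: w) (koenigs_iter s m.+1 _)).
    rewrite (le_lt_trans (ler_normD _ _))//.
    apply: le_lt_trans (vr0 _ hw); rewrite addrC lerD2l (le_trans (PS _ _ IH hw))//.
    by rewrite ler_piMr ?mulr_ge0 ?exprn_ge0// lerBlDr lerDl exprn_ge0.
  have := s3 _ _ sm (small _ _ IH hw); move=> /le_trans; apply.
  by move: h2; rewrite half_sq (exprS (3 / 4)); lra.
move=> vr; elim: k => [|k IH]; first by rewrite addn0 !subrr normr0 mulr0.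
rewrite -(subrKA (koenigs_iter s (n + k) v)) (le_trans (ler_normD _ _))//.
have [_] := Pn (n + k)%N _ vr; rewrite addnS (exprS (3 / 4)); lra.
Qed.

Lemma koenigs_iter_lt n v : `|v| < r -> `|koenigs_iter s n v| < r0.
Proof.
have [_ C0 vr0 _ _] := sb => vr; have := koenigs_iter_diff 0 n vr.
rewrite add0n expr0 /= => nv.
rewrite -(subrK v (koenigs_iter s n v)) (le_lt_trans (ler_normD _ _))//.
apply: le_lt_trans (vr0 _ vr); rewrite addrC lerD2l (le_trans nv)//.
by rewrite ler_piMr ?mulr_ge0 ?exprn_ge0// lerBlDr lerDl exprn_ge0.
Qed.

Lemma koenigs_iter_geometric n k v : `|v| < r ->
  `|koenigs_iter s (n + k) v - koenigs_iter s n v| <= C * `|v| ^+ 2 * (3 / 4) ^+ n.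
Proof.
have [_ C0 _ _ _] := sb => /koenigs_iter_diff /le_trans; apply.
by rewrite ler_wpM2l ?mulr_ge0 ?exprn_ge0// lerBlDr lerDl exprn_ge0.
Qed.

Lemma koenigs_cvg v : `|v| < r ->
  koenigs_iter s n v @[n --> \oo] --> koenigs s v.
Proof.
by move=> vr; have [] := geometric_cvg (fun n k => koenigs_iter_geometric n k vr).
Qed.

Lemma koenigs_iter_approx n v : `|v| < r ->
  `|koenigs s v - koenigs_iter s n v| <= C * `|v| ^+ 2 * (3 / 4) ^+ n.
Proof.
by move=> vr; have [_] := geometric_cvg (fun n k => koenigs_iter_geometric n k vr).
Qed.

Lemma koenigs_approx v : `|v| < r -> `|koenigs s v - v| <= C * `|v| ^+ 2.
Proof. by move=> /(koenigs_iter_approx 0); rewrite expr0 mulr1. Qed.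

Lemma koenigs_lt v : `|v| < r -> `|koenigs s v| < r0.
Proof.
have [_ _ vr0 _ _] := sb => vr; apply: le_lt_trans (vr0 _ vr).
rewrite -[in leLHS](subrK v (koenigs s v)) (le_trans (ler_normD _ _))//.
by rewrite addrC lerD2l koenigs_approx.
Qed.

Lemma koenigs_double v : `|v| < r -> koenigs s v = s (koenigs s (2^-1 *: v)).
Proof.
have [_ C0 _ _ s3] := sb => vr; have hv := half_lt vr.
apply/eqP; rewrite -subr_eq0 -normr_le0.
apply: (@le_geometric0 _ _ (C * `|v| ^+ 2 * (3 / 4) + 3 * (C * `|2^-1 *: v| ^+ 2))) => n.
rewrite -(subrKA (koenigs_iter s n.+1 v)) (le_trans (ler_normD _ _))//.
rewrite [leRHS]mulrDl; apply: lerD.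
  by have := koenigs_iter_approx n.+1 vr; rewrite (exprS (3 / 4)) mulrA.
rewrite (le_trans (s3 _ _ (koenigs_iter_lt n hv) (koenigs_lt hv)))//.
by rewrite -mulrA ler_wpM2l// distrC koenigs_iter_approx.
Qed.

End Bounds.
End Koenigs.

(** * Smoothness of Koenigs maps *)

Section KoenigsSmooth.
Context {R : realType}.

(** Taking tangent maps is functorial, and the tangent map of the halving is the halving of
    [E * E]. *)
Lemma koenigs_iter_tangent {E : completeNormedModType R} (U : set E) (s : E -> E)
    (r0 r C : R) :
  smooth_on U s -> koenigs_bounds s r0 r C -> (forall x, `|x| < r0 -> U x) ->
  forall n v, `|v| < r -> differentiable (koenigs_iter s n) v /\
    forall h, koenigs_iter (tangent s) n (v, h) = tangent (koenigs_iter s n) (v, h).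
Proof.
move=> sC sb r0U; elim=> [|n IH] v vr.
  have [di dE] := is_diff_id v; split => // h.
  by rewrite /tangent /= (_ : 'd (koenigs_iter s 0) v = id :> (E -> E)).
have v2r : `|2^-1 *: v| < r.
  by rewrite normrZ ger0_norm//; have := normr_ge0 v; lra.
have [dn nE] := IH _ v2r.
have dsc : is_diff v ( *:%R (2^-1 : R)) ( *:%R (2^-1 : R)) by exact: is_diff_scaler.
have ds : differentiable s (koenigs_iter s n (2^-1 *: v)).
  by apply: (smooth_on_differentiable sC); apply: r0U; exact: koenigs_iter_lt sb _ _ v2r.
have dSn := is_diff_comp (is_diff_comp dsc (differentiableP dn)) (differentiableP ds).
split => [|h]; first by case: dSn.
rewrite /= [_ *: (v, h)](_ : _ = (2^-1 *: v, 2^-1 *: h))// nE /tangent /=.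
by congr pair; have [_ /(congr1 (@^~ h)) /=] := dSn.
Qed.

(** Convergence of the iterates of [tangent s] near the origin of [E * E] is uniform convergence of
    the derivatives of the iterates of [s], which lets the limit be differentiated. *)
Lemma koenigs_tangent {E : completeNormedModType R} (U : set E) (s : E -> E) :
  doubling U s -> exists2 r : R, 0 < r & forall v, `|v| < r ->
    differentiable (koenigs s) v /\ forall h, `|h| < r ->
      'd (koenigs s) v h = (koenigs (tangent s) (v, h)).2.
Proof.
move=> sd; have [Uo U0 sC s0 ds] := sd.
have [r0 [r [C [sb r0U]]]] := doubling_bounds sd.
have [r0' [r' [C' [sb' _]]]] := doubling_bounds (doubling_tangent sd).
have [r_gt0 _ _ _ _] := sb; have [r'_gt0 C'0 _ _ _] := sb'.
have itT := koenigs_iter_tangent sC sb r0U.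
pose q := Num.min r r'.
have q0 : 0 < q by rewrite lt_min r_gt0.
have qr x : x < q -> x < r by rewrite lt_min => /andP[].
have qr' x : x < q -> x < r' by rewrite lt_min => /andP[].
have pair_lt (v h : E) : `|v| < q -> `|h| < q -> `|(v, h)| < r'.
  by move=> vq hq; rewrite prod_normE /= gt_max !qr'.
have snd_le (p : E * E) : `|p.2| <= `|p| by rewrite prod_normE le_max lexx orbT.
have close n k v h : `|v| < q ->
    `|'d (koenigs_iter s (n + k)) v h - 'd (koenigs_iter s n) v h|
      <= C' * 2 * q * `|h| * (3 / 4) ^+ n.
  move=> vq; have [->|h0] := eqVneq h 0.
    have d0 m : 'd (koenigs_iter s m) v 0 = 0 by exact: linear0.
    by rewrite (d0 (n + k)%N) (d0 n) subrr !normr0 mulr0 mul0r.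
  have n0 : 0 < `|h| by rewrite normr_gt0.
  (* [t *: h] has norm [q / 2], so the geometric bound for [tangent s] applies to it; dividing
     [C' * q ^+ 2] by [t] gives the constant in [close]. *)
  pose t := q / 2 / `|h|.
  have t0 : 0 < t by rewrite !divr_gt0.
  have thq : `|t *: h| < q by rewrite normrZ gtr0_norm// divfK ?gt_eqF//; lra.
  have vhr := pair_lt _ _ vq thq.
  have := koenigs_iter_geometric sb' n k vhr.
  rewrite !(itT _ _ (qr _ vq)).2 => /(le_trans (snd_le _)) /=.
  have dZ m : 'd (koenigs_iter s m) v (t *: h) = t *: 'd (koenigs_iter s m) v h.
    exact: linearZ.
  rewrite (dZ (n + k)%N) (dZ n) -scalerBr normrZ gtr0_norm// -ler_pdivlMl// => /le_trans; apply.
  rewrite mulrA ler_wpM2r ?exprn_ge0//.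
  have vh2 : `|(v, t *: h)| ^+ 2 <= q ^+ 2.
    rewrite lerXn2r ?nnegrE ?(ltW q0)//.
    by rewrite prod_normE ge_max /= !ltW.
  apply: (@le_trans _ _ (t^-1 * (C' * q ^+ 2))).
    by rewrite ler_wpM2l ?invr_ge0 ?(ltW t0)// ler_wpM2l.
  rewrite le_eqVlt; apply/orP; left; apply/eqP; rewrite /t; field.
  by rewrite !gt_eqF.
exists q => // v vq.
have [dk dkE] := is_diff_limit (fun n v vq => (itT n v (qr _ vq)).1)
  (fun v vq => koenigs_cvg sb (qr _ vq)) close vq.
split => // h hq; rewrite dkE.
have /(cvg_comp _ _)/(_ (@cvg_snd _ _ (nbhs _) (nbhs _) _)) :=
  koenigs_cvg sb' (pair_lt _ _ vq hq).
move=> cT; apply: cvg_lim => //.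
rewrite (_ : (fun n => _) = (fun n => (koenigs_iter (tangent s) n (v, h)).2)) //.
by apply/funext => n; rewrite (itT _ _ (qr _ vq)).2.
Qed.

(** Each induction step replaces [s] by [tangent s] and may shrink the radius, so smoothness on a
    fixed ball does not follow yet. *)
Lemma koenigs_Ck (k : nat) {E : completeNormedModType R} (U : set E) (s : E -> E) :
  doubling U s ->
  exists2 r : R, 0 < r & Ck_on k [set v | `|v| < r] (koenigs s).
Proof.
elim: k E U s => [|k IH] E U s sd; have [r1 r10 kT] := koenigs_tangent sd.
  by exists r1 => // v /kT[/differentiable_continuous].
have [r2 r20 TC] := IH _ _ _ (doubling_tangent sd).
pose r := Num.min r1 r2.
have rr1 x : x < r -> x < r1 by rewrite lt_min => /andP[].
have r0 : 0 < r by rewrite lt_min r10.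
exists r => //; split=> [v /rr1 /kT[]//|].
apply: Ck_on_local => -[v h] [/= vr _].
(* The Koenigs map of [tangent s] gives the derivative on short vectors only. Scaling by [t] makes
   the vectors near [h] short, and linearity undoes the scaling. *)
pose t := r / (`|h| + 1).
have t0 : 0 < t by rewrite divr_gt0// ltr_wpDl.
pose l (p : E * E) := (p.1, t *: p.2).
have l_lin : linear l.
  move=> a [x1 x2] [y1 y2]; congr pair.
  by rewrite /= scalerDr !scalerA mulrC.
have l_cont : continuous l.
  move=> p; apply: cvg_pair; first exact: cvg_fst.
  by apply: cvgZr; exact: cvg_snd.
pose W := l @^-1` [set p | `|p| < r].
have Wo : open W.
  by apply: open_comp; [move=> p _; exact: l_cont | exact: open_norm_lt].
exists W.
  rewrite /W /= prod_normE /= gt_max vr /= normrZ gtr0_norm//.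
  by rewrite /t -mulrA gtr_pMr// mulrC ltr_pdivrMr ?ltr_wpDl// mul1r ltrDl.
apply: (@Ck_on_ext _ _ _ _ _
  ((fun q : E * E => t^-1 *: q.2) \o (koenigs (tangent s) \o l))) => //.
  move=> [x y] /=; rewrite /W /= prod_normE /= gt_max => /andP[/rr1 xr yr].
  have [_ /(_ _ (rr1 _ yr)) <-] := kT _ xr.
  by rewrite linearZ /= scalerA mulVf ?scale1r// gt_eqF.
apply: (@Ck_on_comp _ _ _ _ _ _ setT) => //; first exact: openT.
  apply: (@Ck_on_comp _ _ _ _ _ _ [set p | `|p| < r2]) => //.
  - exact: open_norm_lt.
  - by move=> p; rewrite /W /= lt_min => /andP[].
  - exact: Ck_on_linear.
apply: Ck_on_linear => [a x y|p]; first by rewrite /= scalerDr !scalerA mulrC.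
by apply: cvgZr; exact: cvg_snd.
Qed.

(** The equation [e v = s (e (v / 2))] doubles the radius on which [e] is known to be of class C^k.
    As [2 ^ n * q] exceeds every [|v|], the ball of radius [r] is exhausted for each [k]. *)
Lemma koenigs_smooth {E : completeNormedModType R} (U : set E) (s : E -> E)
    (r0 r C : R) :
  doubling U s -> koenigs_bounds s r0 r C -> (forall x, `|x| < r0 -> U x) ->
  smooth_on [set v | `|v| < r] (koenigs s).
Proof.
move=> sd sb r0U k; have [Uo _ sC _ _] := sd.
have [q q0 kC] := koenigs_Ck k sd.
have C2 n : Ck_on k [set v | `|v| < r /\ `|v| < 2 ^+ n * q] (koenigs s).
  elim: n => [|n IH].
    by apply: Ck_on_sub kC => v /= []; rewrite expr0 mul1r.
  have half_lin : linear (fun v : E => 2^-1 *: v).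
    by move=> a u w; rewrite /= scalerDr !scalerA mulrC.
  have half_cont : continuous (fun v : E => 2^-1 *: v) by exact: scaler_continuous.
  have openP m : open [set v : E | `|v| < r /\ `|v| < 2 ^+ m * q].
    by apply: openI; exact: open_norm_lt.
  apply: (@Ck_on_ext _ _ _ _ _ (s \o (koenigs s \o (fun v => 2^-1 *: v)))) => //.
    by move=> v [vr _] /=; rewrite -(koenigs_double sb).
  have half (v : E) : `|v| < r /\ `|v| < 2 ^+ n.+1 * q ->
      `|2^-1 *: v| < r /\ `|2^-1 *: v| < 2 ^+ n * q.
    by rewrite exprS normrZ ger0_norm//; have := normr_ge0 v; lra.
  apply: (@Ck_on_comp _ _ _ _ _ _ U) => //.
  - by move=> v /half[vr _]; apply: r0U; exact: koenigs_lt sb _ vr.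
  - apply: (@Ck_on_comp _ _ _ _ _ _ [set v | `|v| < r /\ `|v| < 2 ^+ n * q]) => //.
    exact: Ck_on_linear.
apply: Ck_on_local => v /= vr.
pose n := Num.bound (`|v| / q).
exists [set v | `|v| < r /\ `|v| < 2 ^+ n * q] => //; split => //.
rewrite -ltr_pdivrMr//; apply: (@lt_trans _ _ n%:R).
  by apply: archi_boundP; rewrite divr_ge0// ltW.
by rewrite -natrX ltr_nat ltn_expl.
Qed.

End KoenigsSmooth.

(** * The inverse function theorem *)

Section InverseFunction.
Context {R : realType}.

(** A solution of [f x = y] is a fixed point of [x |-> x + y - f x]. This map is a contraction with
    constant [1 / 2], and it preserves the closed ball because the target is at most [r / 2] away
    from [f x0]. *)
Lemma near_id_surjective (E : completeNormedModType R) (f : E -> E) (x0 : E) (r : R) :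
    0 <= r ->
    (forall x y, `|x - x0| <= r -> `|y - x0| <= r ->
      `|f x - f y - (x - y)| <= 2^-1 * `|x - y|) ->
  forall y, `|y - f x0| <= r / 2 -> exists2 x, `|x - x0| <= r & f x = y.
Proof.
move=> r0 fid y yr; pose U := [set x | `|x - x0| <= r].
pose h x := x + y - f x.
have hU : set_fun U U h.
  move=> x xr; rewrite /U /h /=.
  have -> : x + y - f x - x0 = - (f x - f x0 - (x - x0)) + (y - f x0).
    rewrite opprB opprB -[RHS]addrA [f x0 - f x + _]addrC subrKA addrACA.
    by rewrite -[LHS]addrA [- f x + _]addrC.
  rewrite (le_trans (ler_normD _ _))// normrN.
  have := fid x x0 xr; rewrite subrr normr0 => /(_ r0).
  by have : `|x - x0| <= r := xr; lra.
pose h' : {fun U >-> U} := HB.pack h (isFun.Build _ _ _ _ h hU).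
have [|||x Ux xE] := @banach_fixed_point _ _ U h'.
- have h0 : (0 : R) <= 2^-1 by rewrite invr_ge0.
  exists (NngNum h0); split; first by rewrite /=; lra.
  move=> [a b] [/= Ua Ub]; change (`|h a - h b| <= 2^-1 * `|a - b|); rewrite /h.
  have -> : a + y - f a - (b + y - f b) = - (f a - f b - (a - b)).
    rewrite [a + y - _]addrAC [b + y - _]addrAC [b - _ + y]addrC addrKA opprB.
    by rewrite opprB opprB addrACA [RHS]addrACA [- f a + _]addrC.
  by rewrite normrN; exact: fid.
- rewrite (_ : U = closed_ball_ Num.norm x0 r); first exact: closed_closed_ball_.
  by apply/seteqP; split=> z; rewrite /U /closed_ball_ /= distrC.
- by exists x0; rewrite /U /= subrr normr0.
exists x => //; move: xE; rewrite -[h' x]/(x + y - f x) -addrA.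
by move=> /eqP; rewrite -subr_eq0 opprD addrA subrr add0r oppr_eq0 subr_eq0 => /eqP.
Qed.

Lemma is_diff_inverse (E F : normedModType R) (f L : E -> F) (g B : F -> E) (y0 : F)
    (V : set F) :
  open V -> V y0 -> (forall y, V y -> f (g y) = y) ->
  {for y0, continuous g} -> is_diff (g y0) f L ->
  linear B -> continuous B -> (forall h, B (L h) = h) ->
  is_diff y0 g B.
Proof.
move=> Vo Vy0 fg /continuous_distP gc [fd fL] Blin Bc BL.
apply: is_diff_dist => // e e0.
pose B' : {linear F -> E} := HB.pack B (GRing.isLinear.Build _ _ _ _ B Blin).
have [b b0 Bb] : exists2 b : R, 0 < b & forall k, `|B k| <= b * `|k|.
  by have := @linear_lipschitz _ _ _ B' Bc.
(* With [D] and [k] the increments of [g] and of its argument, [|D - B k| <= b * e' * |D|]. The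
   first entry turns this into [|D| <= 2 * b * |k|]; the second then makes the error at most
   [e * |k|]. *)
pose e' := Num.min (2 * b)^-1 (e / (2 * b ^+ 2)).
have e'0 : 0 < e' by rewrite lt_min invr_gt0 divr_gt0 ?mulr_gt0 ?exprn_gt0.
have e'1 : e' * b <= 2^-1.
  by rewrite -ler_pdivlMr// -invfM ge_min lexx.
have e'2 : e' * (2 * b ^+ 2) <= e.
  by rewrite -ler_pdivlMr ?mulr_gt0 ?exprn_gt0// ge_min lexx orbT.
have [d1 d10 dP] := diff_dist fd e'0.
have [d2 d20 gP] := gc _ d10.
have [d3 d30 VP] := open_dist Vo Vy0.
exists (Num.min d2 d3); first by rewrite lt_min d20.
move=> y; rewrite lt_min => /andP[/gP/dP + /VP/fg fgy].
rewrite fgy (fg _ Vy0) fL; set D := g y - g y0; set k := y - y0 => h1.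
have BE : B (k - L D) = B k - D by rewrite -[B _]/(B' _) linearB /= BL.
have h2 : `|D - B k| <= b * (e' * `|D|).
  by rewrite distrC -BE (le_trans (Bb _))// ler_wpM2l// ltW.
have h3 : `|D| <= 2 * b * `|k|.
  have : `|D| <= `|D - B k| + `|B k| by rewrite -{1}(subrK (B k) D) ler_normD.
  by have := Bb k; have := normr_ge0 D; nra.
apply: (le_trans h2); have := normr_ge0 k.
have : b * (e' * `|D|) <= b * (e' * (2 * b * `|k|)).
  by rewrite ler_wpM2l ?(ltW b0)// ler_wpM2l// ltW.
rewrite (_ : b * (e' * (2 * b * `|k|)) = e' * (2 * b ^+ 2) * `|k|); last by ring.
by move=> + k0 => /le_trans; apply; rewrite ler_wpM2r.
Qed.

Section NearIdentity.
Context {E : completeNormedModType R} (f : E -> E) (r : R).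
Let Br := [set v : E | `|v| < r].
Hypothesis fC : smooth_on Br f.
Hypothesis fid : forall x y, Br x -> Br y ->
  `|f x - f y - (x - y)| <= 2^-1 * `|x - y|.

Let Bo : open Br. Proof. exact: open_norm_lt. Qed.
Let BTo : open (Br `*` [set: E]).
Proof. by apply: open_setX => //; exact: openT. Qed.

Lemma near_id_diff x h : Br x -> `|'d f x h - h| <= 2^-1 * `|h|.
Proof.
move=> xr; have [->|h0] := eqVneq h 0; first by rewrite linear0 subr0 !normr0 mulr0.
have n0 : 0 < `|h| by rewrite normr_gt0.
rewrite -ler_pdivrMr//; apply/ler_addgt0Pr => e e0; rewrite ler_pdivrMr//.
have [d d0 dP] := diff_dist (smooth_on_differentiable fC xr) e0.
have [d' d'0 BP] := open_dist Bo xr.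
pose m := Num.min d d'; have m0 : 0 < m by rewrite lt_min d0.
have [t t0 thm] : exists2 t : R, 0 < t & `|t *: h| < m.
  exists (m / 2 / `|h|); first by rewrite !divr_gt0.
  by rewrite normrZ gtr0_norm ?divr_gt0// divfK ?gt_eqF//; lra.
have := dP (x + t *: h); have := BP (x + t *: h).
rewrite [x + _]addrC addrK; move: (thm); rewrite {1}lt_min => /andP[td td'].
move=> /(_ td') /fid/(_ xr); rewrite addrK => h1 /(_ td) h2.
have : `|t *: ('d f x h - h)| <= (2^-1 + e) * `|t *: h|.
  rewrite scalerBr -[t *: 'd f x h]linearZ /=.
  rewrite -(subrKA (f (t *: h + x) - f x)) (le_trans (ler_normD _ _))//.
  by rewrite (distrC ('d f x _)) mulrDl addrC lerD.
by rewrite !normrZ (gtr0_norm t0) mulrCA (ler_pM2l t0).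
Qed.

Let near_id_lin (x h k : E) : Br x -> `|'d f x h - 'd f x k - (h - k)| <= 2^-1 * `|h - k|.
Proof.
move=> xr; have := near_id_diff (h - k) xr.
by rewrite linearB.
Qed.

(** Point and vector are arguments on the same footing, so that joint smoothness can be expressed.
    The default [0] never occurs for [x] in [Br], where ['d f x] is onto. *)
Definition diff_inv (x h : E) : E := xget 0 [set z | 'd f x z = h].

Lemma diff_invK x h : Br x -> 'd f x (diff_inv x h) = h.
Proof.
move=> xr; apply: (@xgetPex _ 0 [set z | 'd f x z = h]).
(* ['d f x] is itself near the identity, on every ball; half of the radius [2 * |h|] is the distance
   from [h] to ['d f x 0 = 0]. *)
have [|a b _ _||z _ zh] := @near_id_surjective _ ('d f x) 0 (2 * `|h|) _ _ h.
- by rewrite mulr_ge0.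
- exact: near_id_lin.
- by rewrite linear0 subr0 mulrAC divff ?mul1r.
by exists z.
Qed.

Lemma near_id_diff_ge x h : Br x -> `|h| <= 2 * `|'d f x h|.
Proof.
move=> /(near_id_diff h); have := ler_normB ('d f x h) ('d f x h - h).
by rewrite opprB addrC subrK; lra.
Qed.

Lemma diffK x z : Br x -> diff_inv x ('d f x z) = z.
Proof.
move=> xr; apply/eqP; rewrite -subr_eq0 -normr_le0.
by rewrite (le_trans (near_id_diff_ge _ xr))// linearB /= diff_invK// subrr normr0 mulr0.
Qed.

Lemma diff_inv_linear x : Br x -> linear (diff_inv x).
Proof.
move=> xr a h k; rewrite -[RHS](diffK _ xr); congr (diff_inv x _).
by rewrite linearP /= !diff_invK.
Qed.

Lemma diff_inv_le x h : Br x -> `|diff_inv x h| <= 2 * `|h|.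
Proof. by move=> xr; have := near_id_diff_ge (diff_inv x h) xr; rewrite diff_invK. Qed.

Let j2 (p : E * E) : E * E := (p.1, diff_inv p.1 p.2).

(** The distance of [diff_inv y k] from [diff_inv x h] is at most [2 * |k - 'd f y (diff_inv x h)|],
    which tends to [0] by joint continuity of ['d f]. *)
Lemma diff_inv_continuous p : Br p.1 -> {for p, continuous j2}.
Proof.
case: p => x h /= xr; apply: cvg_pair; first exact: cvg_fst.
have dc : {for (x, diff_inv x h), continuous (fun p : E * E => 'd f (p.1) p.2)}.
  by apply: (smooth_on_continuous (smooth_on_diff fC)).
have : {for (x, h), continuous (fun p : E * E => diff_inv p.1 p.2)}; last exact.
apply/continuous_distP => e e0.
have e4 : 0 < e / 4 by rewrite divr_gt0.
have /continuous_distP/(_ _ e4)[d d0 dP] := dc.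
have [d' d'0 BP] := open_dist Bo xr.
exists (Num.min (e / 4) (Num.min d d')); first by rewrite !lt_min e4 d0.
move=> [y k]; rewrite !lt_min prod_normE /= !gt_max.
move=> /and3P[/andP[_ kh] /andP[yd _] /andP[/BP yr _]].
have /dP : `|(y, diff_inv x h) - (x, diff_inv x h)| < d.
  by rewrite prod_normE /= subrr normr0 gt_max yd.
rewrite /= diff_invK// => h1.
apply: (le_lt_trans (near_id_diff_ge _ yr)); rewrite linearB /= diff_invK//.
rewrite -(subrKA h); have := ler_normD (k - h) (h - 'd f y (diff_inv x h)).
by rewrite (distrC h); lra.
Qed.

(* [j2] is inverse to [(x, z) |-> (x, 'd f x z)], whose derivative is
   triangular; this gives the derivative of [j2] in terms of [j2] itself. *)
Let dj2 (p q : E * E) : E * E := (q.1, diff_inv p.1 (q.2 -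
  'd (fun p : E * E => 'd f (p.1) p.2) (p.1, diff_inv p.1 p.2) (q.1, 0))).

Lemma diff_inv_is_diff p : Br p.1 -> is_diff p j2 (dj2 p).
Proof.
case: p => x h /= xr; set z := diff_inv x h.
pose A := fun p : E * E => 'd f (p.1) p.2.
have dA : differentiable A (x, z).
  by apply: (smooth_on_differentiable (smooth_on_diff fC)).
pose f2 (p : E * E) := (p.1, A p).
have d1 : is_diff (x, z) (@fst E E) fst.
  by apply: is_diff_linear => [//|p]; exact: cvg_fst.
have df2 : is_diff (x, z) f2 (fun q => (q.1, 'd A (x, z) q)).
  exact: (is_diff_pair d1 (differentiableP dA)).
apply: (@is_diff_inverse _ _ f2 (fun q => (q.1, 'd A (x, z) q)) _ _ _
  (Br `*` [set: E])) => //.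
- by move=> [y k] [yr _]; rewrite /f2 /j2 /A /= diff_invK.
- exact: diff_inv_continuous.
- move=> a [x1 h1] [x2 h2]; congr pair => /=; rewrite -diff_inv_linear//.
  congr (diff_inv x _).
  have -> : (a *: x1 + x2, 0) = a *: (x1, 0) + (x2, 0) :> E * E.
    by congr pair; rewrite /= scaler0 addr0.
  by rewrite linearP /= scalerBr opprD addrACA.
- move=> q; apply: cvg_pair; first exact: cvg_fst.
  have Jc : continuous (diff_inv x).
    apply: (@linear_le_continuous _ _ _ _ 2); first exact: diff_inv_linear.
    by move=> k; exact: diff_inv_le.
  have c1 : {for q, continuous (fun q : E * E => (q.1, 0 : E))}.
    by apply: cvg_pair; [exact: cvg_fst | exact: cvg_cst].
  have c2 : {for q, continuous ('d A (x, z) \o (fun q : E * E => (q.1, 0 : E)))}.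
    by apply: (continuous_comp c1); exact: diff_continuous.
  have c3 : {for q, continuous (fun q : E * E => q.2 - 'd A (x, z) (q.1, 0))}.
    by apply: cvgB; [exact: cvg_snd | exact: c2].
  exact: (continuous_comp c3 (Jc _)).
move=> [x1 z1]; congr pair => /=.
rewrite -(linearB ('d A (x, z))) -[RHS](diffK _ xr); congr (diff_inv x _).
rewrite (_ : _ - _ = (0, z1)); first exact: (diff_diff_snd _ _ fC xr).
by congr pair; rewrite /= ?subrr ?subr0.
Qed.

(** A bootstrap: the derivative [dj2] is composed of the smooth second derivative of [f] and two
    nested uses of [j2], so class C^k of [j2] gives class C^(k+1). *)
Lemma diff_inv_smooth : smooth_on (Br `*` [set: E]) j2.
Proof.
elim=> [|k IH]; first by move=> p [pr _]; exact: diff_inv_continuous.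
split=> [p [pr _]|]; first by have [] := diff_inv_is_diff pr.
have Uo : open ((Br `*` [set: E]) `*` [set: E * E]).
  by apply: open_setX => //; exact: openT.
apply: (@Ck_on_ext _ _ _ _ _ (fun q : (E * E) * (E * E) => dj2 q.1 q.2)) => //.
  by move=> [p q] [[pr _] _] /=; have [_ ->] := diff_inv_is_diff pr.
have lin1 : Ck_on k ((Br `*` [set: E]) `*` [set: E * E])
    (fun q : (E * E) * (E * E) => q.2.1).
  apply: Ck_on_linear => [//|q].
  by apply: continuous_comp; [exact: cvg_snd | exact: cvg_fst].
have lin2 : Ck_on k ((Br `*` [set: E]) `*` [set: E * E])
    (fun q : (E * E) * (E * E) => q.2.2).
  apply: Ck_on_linear => [//|q].
  by apply: continuous_comp; [exact: cvg_snd | exact: cvg_snd].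
have lin3 : Ck_on k ((Br `*` [set: E]) `*` [set: E * E])
    (fun q : (E * E) * (E * E) => q.1.1).
  apply: Ck_on_linear => [//|q].
  by apply: continuous_comp; [exact: cvg_fst | exact: cvg_fst].
have j2C : Ck_on k ((Br `*` [set: E]) `*` [set: E * E])
    (fun q : (E * E) * (E * E) => j2 q.1).
  apply: (@Ck_on_comp _ _ _ _ _ _ (Br `*` [set: E]) fst j2) => //.
    by move=> q [].
  by apply: Ck_on_linear => [//|q]; exact: cvg_fst.
have m1 : Ck_on k ((Br `*` [set: E]) `*` [set: E * E])
    (fun q : (E * E) * (E * E) => (j2 q.1, (q.2.1, 0 : E))).
  by do 2!apply: Ck_on_pair => //; exact: Ck_on_cst.
have m2 : Ck_on k ((Br `*` [set: E]) `*` [set: E * E])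
    (fun q : (E * E) * (E * E) =>
      - 'd (fun p : E * E => 'd f (p.1) p.2) (j2 q.1) (q.2.1, 0 : E)).
  apply: (@Ck_on_comp _ _ _ _ _ _ setT _ (fun x : E => - x)) => //; first exact: openT.
    have /(_ k) dA := smooth_on_diff (smooth_on_diff fC).
    apply: (Ck_on_comp Uo _ _ m1 dA); first by apply: open_setX => //; exact: openT.
    by move=> q [[]].
  by apply: Ck_on_linear => [a u v|v]; [rewrite opprD scalerN | exact: opp_continuous].
have m3 := Ck_on_pair Uo lin3 (Ck_on_add Uo lin2 m2).
have m4 : Ck_on k ((Br `*` [set: E]) `*` [set: E * E])
    (snd \o (j2 \o (fun q : (E * E) * (E * E) => (q.1.1, q.2.2 +
      - 'd (fun p : E * E => 'd f (p.1) p.2) (j2 q.1) (q.2.1, 0 : E))))).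
  apply: (@Ck_on_comp _ _ _ _ _ _ setT) => //; first exact: openT.
    by apply: (Ck_on_comp Uo BTo _ m3 IH) => q [[]].
  by apply: Ck_on_linear => [//|q]; exact: cvg_snd.
exact: (Ck_on_pair Uo lin1 m4).
Qed.

Definition near_id_inv (y : E) : E := xget 0 [set x | Br x /\ f x = y].

Lemma near_id_le x y : Br x -> Br y -> `|x - y| <= 2 * `|f x - f y|.
Proof.
move=> xr yr; have := fid xr yr; have := ler_normB (f x - f y) (f x - f y - (x - y)).
by rewrite opprB addrC subrK; lra.
Qed.

Lemma near_id_inv_mem y : (f @` Br) y -> Br (near_id_inv y).
Proof.
move=> [x xr <-].
by have [] := @xgetPex _ 0 [set z | Br z /\ f z = f x]; first by exists x.
Qed.

Lemma near_id_invK y : (f @` Br) y -> f (near_id_inv y) = y.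
Proof.
move=> [x xr <-].
by have [] := @xgetPex _ 0 [set z | Br z /\ f z = f x]; first by exists x.
Qed.

Lemma near_idK x : Br x -> near_id_inv (f x) = x.
Proof.
move=> xr; have Vx : (f @` Br) (f x) by exists x.
apply/eqP; rewrite -subr_eq0 -normr_le0.
rewrite (le_trans (near_id_le (near_id_inv_mem Vx) xr))//.
by rewrite near_id_invK// subrr normr0 mulr0.
Qed.

Lemma near_id_open (U : set E) : open U -> U `<=` Br -> open (f @` U).
Proof.
move=> Uo UB; rewrite openE => _ [x Ux <-].
have [d d0 dP] := open_dist Uo Ux.
have d2 y : `|y - x| <= d / 2 -> U y by move=> yd; apply: dP; lra.
(* The closed ball of radius [d / 2] lies in [U], and its image contains the ball of half that
   radius. *)
apply/nbhs_distP; exists (d / 4); first by rewrite divr_gt0.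
move=> y yd; have [|a b /d2 Ua /d2 Ub||z /d2 Uz zy] :=
  @near_id_surjective _ f x (d / 2) _ _ y.
- by rewrite divr_ge0// ltW.
- by apply: fid; exact: UB.
- by lra.
by exists z.
Qed.

(** The inverse [g] has derivative [(y, h) |-> diff_inv (g y) h], a smooth map after [g]; so each
    order of smoothness of [g] yields the next. *)
Lemma near_id_inv_smooth : smooth_on (f @` Br) near_id_inv.
Proof.
have Vo : open (f @` Br) by exact: near_id_open.
have gc y : (f @` Br) y -> {for y, continuous near_id_inv}.
  move=> Vy; have [d d0 dP] := open_dist Vo Vy.
  apply/continuous_distP => e e0; exists (Num.min (e / 2) d).
    by rewrite lt_min divr_gt0.
  move=> z; rewrite lt_min => /andP[ze /dP Vz].
  apply: le_lt_trans (near_id_le (near_id_inv_mem Vz) (near_id_inv_mem Vy)) _.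
  by rewrite !near_id_invK//; lra.
have gd y : (f @` Br) y -> is_diff y near_id_inv (diff_inv (near_id_inv y)).
  move=> Vy; have yr := near_id_inv_mem Vy.
  apply: (@is_diff_inverse _ _ f ('d f (near_id_inv y)) _ _ _ (f @` Br)) => //.
  - exact: near_id_invK.
  - exact: gc.
  - exact/differentiableP/(smooth_on_differentiable fC).
  - exact: diff_inv_linear.
  - apply: (@linear_le_continuous _ _ _ _ 2); first exact: diff_inv_linear.
    by move=> h; exact: diff_inv_le.
  - by move=> h; exact: diffK.
elim=> [|k IH]; first by move=> y /gc.
split=> [y /gd[]//|].
have UT : open ((f @` Br) `*` [set: E]) by apply: open_setX => //; exact: openT.
apply: (@Ck_on_ext _ _ _ _ _
  (snd \o (j2 \o (fun p : E * E => (near_id_inv p.1, p.2))))) => //.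
  by move=> [y h] [/= /gd[_ ->]].
apply: (@Ck_on_comp _ _ _ _ _ _ setT) => //; first exact: openT.
  apply: (Ck_on_comp UT BTo _ _ (diff_inv_smooth k)).
    by move=> p [/near_id_inv_mem].
  apply: Ck_on_pair => //.
    apply: (@Ck_on_comp _ _ _ _ _ _ (f @` Br) fst) => //; first by move=> p [].
    by apply: Ck_on_linear => [//|q]; exact: cvg_fst.
  by apply: Ck_on_linear => [//|q]; exact: cvg_snd.
by apply: Ck_on_linear => [//|q]; exact: cvg_snd.
Qed.

End NearIdentity.
End InverseFunction.

(** * Involutions with an isolated fixed point *)

Section Involutions.
Context {R : realType}.

(* Averaging conjugates the involution [sg] to its linear part [A] by a local
   homeomorphism [hh], so that fixed vectors of [A] give fixed points of [sg]. *)
Lemma involution_isolated_diff (E : completeNormedModType R) (U : set E)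
    (sg : E -> E) (d : R) :
  open U -> U 0 -> smooth_on U sg -> sg 0 = 0 ->
  (forall x, U x -> sg (sg x) = x) ->
  0 < d -> (forall x, `|x| < d -> sg x = x -> x = 0) ->
  forall h, 'd sg 0 h = - h.
Proof.
move=> Uo U0 sC s0 sK d0 fix0.
have ds := smooth_on_differentiable sC U0.
pose A := 'd sg 0.
have AA h : A (A h) = h.
  have ds' : differentiable sg (sg 0) by rewrite s0.
  have dss := is_diff_comp (differentiableP ds) (differentiableP ds').
  have [_ ssE] := is_diff_ext Uo U0 sK dss.
  have [_ idE] := is_diff_id (0 : E).
  have /(congr1 (@^~ h)) /= := etrans (esym ssE) idE.
  by rewrite s0.
have [k k0 Ak] := linear_lipschitz (diff_continuous ds).
have [r1 [C [r10 C0 r1U sq]]] := smooth_on_quadratic Uo U0 sC.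
(* [k * C * |x| <= 1] on this ball, so that averaging leaves [hh] minus the identity with Lipschitz
   constant [1 / 2]. *)
pose r := Num.min r1 (k * C + 1)^-1.
have kC0 : 0 <= k * C by rewrite mulr_ge0 ?(ltW k0).
have r0 : 0 < r by rewrite lt_min r10 invr_gt0 ltr_wpDl.
have rr1 x : x < r -> x < r1 by rewrite lt_min => /andP[].
have rkC x : 0 <= x -> x < r -> k * C * x <= 1.
  move=> x0; rewrite lt_min => /andP[_]; rewrite -[_^-1]mul1r ltr_pdivlMr ?ltr_wpDl//.
  by move=> /ltW; lra.
pose hh x := 2^-1 *: (x + A (sg x)).
have hhE x y : hh x - hh y - (x - y) = 2^-1 *: A (sg x - sg y - A (x - y)).
  have -> : A (sg x - sg y - A (x - y)) = A (sg x) - A (sg y) - (x - y).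
    by rewrite [LHS]linearB AA; congr (_ - _); exact: linearB.
  have half2 : x - y = 2^-1 *: (2 *: (x - y)) by rewrite scalerA mulVf ?scale1r.
  rewrite {1}half2 /hh -!scalerBr; congr (_ *: _).
  rewrite opprD addrACA -[2]/(1 + 1) scalerDl scale1r opprD.
  by rewrite [LHS]addrA [x - y + _]addrC addrK.
have hid x y : `|x| < r -> `|y| < r -> `|hh x - hh y - (x - y)| <= 2^-1 * `|x - y|.
  move=> xr yr; rewrite hhE normrZ ger0_norm ?invr_ge0// ler_wpM2l ?invr_ge0//.
  rewrite (le_trans (Ak _))//.
  have := sq x y; rewrite !subr0 => /(_ (rr1 _ xr) (rr1 _ yr)) sxy.
  have : k * C * Num.max `|x| `|y| <= 1 
    by apply: rkC; [rewrite le_max normr_ge0 | rewrite gt_max xr].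
  move=> kCm; apply: (@le_trans _ _ (k * (C * Num.max `|x| `|y| * `|x - y|))).
    by rewrite ler_wpM2l// ltW.
  by rewrite !mulrA ler_piMl.
have [d1 d10 sd1] : exists2 e : R, 0 < e & forall x, `|x| < e -> `|sg x| < r.
  have /continuous_distP/(_ _ r0)[e e0 eP] := smooth_on_continuous sC U0.
  by exists e => // x xe; have := eP x; rewrite s0 !subr0; exact.
(* The half makes the closed ball of radius [q] fit into all three open balls. *)
pose q := Num.min (Num.min r d) d1 / 2.
have q0 : 0 < q by rewrite divr_gt0// 2!lt_min r0 d0 d10.
have ql x : `|x| <= q -> [/\ `|x| < r, `|x| < d & `|x| < d1].
  move=> xq; have : `|x| < Num.min (Num.min r d) d1 by rewrite /q in xq q0; lra.
  by rewrite 2!lt_min => /andP[/andP[]].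
have fixA w : A w = w -> w = 0.
  move=> Aw; have [//|w0] := eqVneq w 0.
  have n0 : 0 < `|w| by rewrite normr_gt0.
  pose t := q / 2 / `|w|; have t0 : 0 < t by rewrite divr_gt0// divr_gt0.
  have tw : `|t *: w| <= q / 2.
    by rewrite normrZ gtr0_norm// divfK ?gt_eqF.
  have hh0 : hh 0 = 0 by rewrite /hh s0 linear0 addr0 scaler0.
  have [|||x] := @near_id_surjective _ _ hh 0 q _ _ (t *: w).
  - exact: ltW.
  - by move=> x y; rewrite !subr0 => /ql[xr _ _] /ql[yr _ _]; exact: hid.
  - by rewrite hh0 subr0.
  rewrite subr0 => /ql[xr xd /sd1 sxr] hx.
  have Ux : U x by apply: r1U; rewrite subr0; exact: rr1.
  (* [hh] intertwines [sg] with [A], and [hh x] is fixed by [A]; as [hh] is injective near [0], it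
     will follow that [sg x = x]. *)
  have hs : hh (sg x) = hh x.
    have Ah : A (hh x) = hh x.
      by rewrite hx; transitivity (t *: A w); [exact: linearZ | rewrite Aw].
    rewrite -Ah; transitivity (2^-1 *: (A x + A (A (sg x)))); last first.
      rewrite /hh; transitivity (2^-1 *: A (x + A (sg x))).
        by congr (_ *: _); symmetry; exact: linearD.
      by symmetry; exact: linearZ.
    by rewrite AA /hh sK// addrC.
  have := hid _ _ sxr xr; rewrite hs subrr sub0r normrN => sx.
  have /fix0 : sg x = x.
    by apply/eqP; rewrite -subr_eq0 -normr_le0; lra.
  move=> /(_ xd) x0; move: hx; rewrite x0 hh0 => /esym/eqP.
  by rewrite scaler_eq0 gt_eqF//= => /eqP.
(* [A h + h] is fixed by the involution [A], hence zero. *)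
move=> h; apply/eqP; rewrite -addr_eq0; apply/eqP/fixA.
by transitivity (A (A h) + A h); [exact: linearD | rewrite AA addrC].
Qed.

End Involutions.

(** * Normal coordinates *)

Section NormalCoordinates.
Context {R : realType}.

(** [r] bounds the vectors given to [e], [r0] the points where [s] is controlled. Naturality rests
    on the approximation, doubling and Lipschitz fields, the chart on smoothness and nearness to the
    identity. *)
Record normal_coordinates {E : completeNormedModType R} (U : set E)
    (s e : E -> E) (r C r0 : R) : Prop := NormalCoordinates {
  nc_radius : 0 < r;
  nc_const : 0 <= C;
  nc_smooth : smooth_on [set v | `|v| < r] e;
  nc_near_id : forall v w, `|v| < r -> `|w| < r ->
    `|e v - e w - (v - w)| <= 2^-1 * `|v - w|;
  nc_approx : forall v, `|v| < r -> `|e v - v| <= C * `|v| ^+ 2;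
  nc_double : forall v, `|v| < r -> e v = s (e (2^-1 *: v));
  nc_lt : forall v, `|v| < r -> `|e v| < r0;
  nc_dom : forall x, `|x| < r0 -> U x;
  nc_lipschitz : forall x y, `|x| < r0 -> `|y| < r0 ->
    `|s x - s y| <= 3 * `|x - y|
}.

Lemma doubling_normal_coordinates {E : completeNormedModType R} (U : set E)
    (s : E -> E) : doubling U s ->
  exists e r C r0, normal_coordinates U s e r C r0.
Proof.
move=> sd; have [r0 [r [C [sb r0U]]]] := doubling_bounds sd.
have [r_gt0 C0 _ _ s3] := sb.
have eC := koenigs_smooth sd sb r0U.
set e := koenigs s in eC.
have ea : forall v, `|v| < r -> `|e v - v| <= C * `|v| ^+ 2.
  by move=> v; exact: koenigs_approx sb _.
have B0 : [set v : E | `|v| < r] 0 by rewrite /= normr0.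
have e0 : e 0 = 0.
  by apply/eqP; have := ea 0 B0; rewrite normr0 expr0n mulr0 subr0 normr_le0.
have de : is_diff (0 : E) e id.
  apply: is_diff_dist => // [x|eps eps0]; first exact: cvg_id.
  exists (Num.min r (eps / (C + 1))).
    by rewrite lt_min r_gt0 divr_gt0// ltr_wpDl.
  move=> v; rewrite e0 !subr0 lt_min => /andP[/ea vr].
  rewrite ltr_pdivlMr ?ltr_wpDl// => vC; apply: (le_trans vr).
  by rewrite expr2 mulrA ler_wpM2r//; have := normr_ge0 v; nra.
have [r1 [C1 [r10 C10 _ sq]]] := smooth_on_quadratic (open_norm_lt E r) B0 eC.
(* [e] has derivative the identity at [0], and [C1 * |x| <= 1 / 2] on this ball; together they give
   the constant of [nc_near_id]. *)
pose q := Num.min r (Num.min r1 (2 * (C1 + 1))^-1).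
have q0 : 0 < q by rewrite 2!lt_min r_gt0 r10 invr_gt0 mulr_gt0// ltr_wpDl.
have qr x : x < q -> x < r by rewrite lt_min => /andP[].
have qr1 x : x < q -> x < r1 by rewrite 2!lt_min => /and3P[].
have qC x : 0 <= x -> x < q -> C1 * x <= 2^-1.
  move=> x0; rewrite 2!lt_min => /and3P[_ _]; rewrite -[_^-1]mul1r.
  by rewrite ltr_pdivlMr ?mulr_gt0 ?ltr_wpDl// => xC; nra.
exists e, q, C, r0; split => //.
- by apply: smooth_on_sub eC => v /= /qr.
- move=> v w vq wq; have := sq v w; rewrite !subr0 => /(_ (qr1 _ vq) (qr1 _ wq)).
  have [_ ->] := de => /le_trans; apply; rewrite ler_wpM2r//.
  by apply: qC; [rewrite le_max normr_ge0 | rewrite gt_max vq].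
- by move=> v /qr /ea.
- by move=> v /qr vr; exact: koenigs_double sb _ vr.
- by move=> v /qr vr; exact: koenigs_lt sb _ vr.
Qed.

Lemma normal_coordinates0 {E : completeNormedModType R} (U : set E)
  (s e : E -> E) (r C r0 : R) : normal_coordinates U s e r C r0 -> e 0 = 0.
Proof.
move=> ne; have := nc_approx ne (v := 0); rewrite normr0 => /(_ (nc_radius ne)).
by rewrite expr0n mulr0 subr0 normr_le0 => /eqP.
Qed.

(* Both sides solve [F w = s' (F (w / 2))] and they agree to second order,
   while [s'] expands distances by a factor [3 < 2 ^ 2] at most. *)
Lemma normal_coordinates_natural {E E' : completeNormedModType R}
    (U W : set E) (U' : set E') (s e : E -> E) (s' e' : E' -> E')
    (r C r0 r' C' r0' : R) (j : E -> E') :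
  normal_coordinates U s e r C r0 -> normal_coordinates U' s' e' r' C' r0' ->
  open W -> W 0 -> smooth_on W j -> j 0 = 0 ->
  (forall w, U w -> W w -> j (s w) = s' (j w)) ->
  exists2 q : R, 0 < q & forall w, `|w| < q ->
    [/\ `|w| < r, `|'d j 0 w| < r', W (e w) & j (e w) = e' ('d j 0 w)].
Proof.
move=> ne ne' Wo W0 jC j0 js.
have dj := smooth_on_differentiable jC W0.
have [k k0 Ak] := linear_lipschitz (diff_continuous dj).
have [r1 [D [r10 D0 r1W sq]]] := smooth_on_quadratic Wo W0 jC.
set A := 'd j 0 in Ak sq *.
have [rp Cp r'p C'p] := And4 (nc_radius ne) (nc_const ne) (nc_radius ne') (nc_const ne').
have r0'p : 0 < r0' by apply: le_lt_trans (nc_lt ne' (v := 0) _); rewrite ?normr0.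
have quad v : `|v| < r1 -> `|j v - A v| <= D * `|v| ^+ 2.
  move=> vr; have := sq v 0; rewrite j0 !subr0 normr0 => /(_ vr r10).
  by rewrite max_l ?normr_ge0// expr2 mulrA.
(* For [|v| < r1] one has [|j v| <= |v| * (k + D * r1)], so this radius keeps [j v] where [s'] is
   Lipschitz. *)
pose q1 := Num.min r1 (r0' / (k + D * r1 + 1)).
have den : 0 < k + D * r1 + 1.
  by rewrite ltr_wpDl// addr_ge0// ?(ltW k0)// mulr_ge0// ltW.
have q1p : 0 < q1 by rewrite lt_min r10 divr_gt0.
have jlt v : `|v| < q1 -> W v /\ `|j v| < r0'.
  rewrite lt_min => /andP[vr]; rewrite ltr_pdivlMr// => vd.
  split; first by apply: r1W; rewrite subr0.
  rewrite -(subrK (A v) (j v)) (le_lt_trans (ler_normD _ _))//.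
  apply: le_lt_trans vd; rewrite mulrDr mulr1 mulrDr.
  have := quad _ vr; have := Ak v; have := normr_ge0 v.
  have : D * `|v| ^+ 2 <= `|v| * (D * r1).
    by rewrite expr2 mulrCA ler_wpM2l// ler_wpM2l// ltW.
  by lra.
(* In order: [w] is admissible for [e], [A w] for [e'], and [e w] lies in the ball of radius [q1].
   The last uses [|e w| <= 2 * |w|], which the bound [(C + 1)^-1] provides. *)
pose q := Num.min (Num.min r (r' / k)) (Num.min (q1 / 2) (C + 1)^-1).
have qp : 0 < q.
  by rewrite /q !(lt_min (0 : R) _ _) rp invr_gt0 ltr_wpDl// !divr_gt0.
have qP w : `|w| < q -> [/\ `|w| < r, `|A w| < r', `|e w| < q1 & `|e w| <= 2 * `|w|].
  rewrite lt_min => /andP[]; rewrite lt_min => /andP[wr]; rewrite ltr_pdivlMr// => wk.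
  rewrite lt_min => /andP[wq1]; rewrite -[_^-1]mul1r ltr_pdivlMr ?ltr_wpDl// => wC.
  have ew : `|e w| <= 2 * `|w|.
    rewrite -(subrK w (e w)) (le_trans (ler_normD _ _))//.
    have := nc_approx ne wr; rewrite expr2; have := normr_ge0 w; nra.
  split => //; last by lra.
  by rewrite (le_lt_trans (Ak w))// mulrC.
have half (w : E) : `|w| < q -> `|2^-1 *: w| < q.
  by rewrite normrZ ger0_norm ?invr_ge0//; have := normr_ge0 w; lra.
(* The three errors at [n = 0]: [j] against [A] at [e w], where [|e w| <= 2 * |w|]; [e w] against
   [w] under [A]; and [e' (A w)] against [A w]. *)
pose K := 4 * D + k * C + C' * k ^+ 2.
have K0 : 0 <= K.
  by rewrite !addr_ge0// mulr_ge0// ?(ltW k0)// exprn_ge0// ltW.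
have close n w : `|w| < q ->
    `|j (e w) - e' (A w)| <= K * `|w| ^+ 2 * (3 / 4) ^+ n.
  elim: n w => [|n IH] w wq; have [wr Aw ew ew2] := qP _ wq.
    have ewr1 : `|e w| < r1 by apply: (lt_le_trans ew); rewrite ge_min lexx.
    rewrite expr0 mulr1 -(subrKA (A (e w))) (le_trans (ler_normD _ _))//.
    have -> : A (e w) - e' (A w) = A (e w - w) - (e' (A w) - A w).
      rewrite (_ : A (e w - w) = A (e w) - A w); last exact: linearB.
      by rewrite opprB addrA subrK.
    have h1 := quad _ ewr1.
    have h2 : `|A (e w - w) - (e' (A w) - A w)|
        <= k * (C * `|w| ^+ 2) + C' * (k * `|w|) ^+ 2.
      rewrite (le_trans (ler_normB _ _))// lerD//.
        by rewrite (le_trans (Ak _))// ler_wpM2l ?(ltW k0)// (nc_approx ne).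
      rewrite (le_trans (nc_approx ne' Aw))// ler_wpM2l// lerXn2r// ?nnegrE//.
      by rewrite mulr_ge0// ltW.
    have h3 : D * `|e w| ^+ 2 <= D * (2 * `|w|) ^+ 2.
      by rewrite ler_wpM2l// lerXn2r// ?nnegrE// mulr_ge0.
    apply: (le_trans (lerD h1 h2)).
    by rewrite /K; move: h3; rewrite !exprMn; lra.
  have wq2 := half _ wq; have [w2r Aw2 ew2' _] := qP _ wq2.
  have [We jr0] := jlt _ ew2'.
  rewrite (nc_double ne wr) js//; last exact: (nc_dom ne (nc_lt ne w2r)).
  have -> : e' (A w) = s' (e' (A (2^-1 *: w))).
    rewrite (nc_double ne' Aw); congr (s' (e' _)); symmetry; exact: linearZ.
  rewrite (le_trans (nc_lipschitz ne' jr0 (nc_lt ne' Aw2)))//.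
  have := IH _ wq2; rewrite normrZ ger0_norm ?invr_ge0// exprMn (exprS (3 / 4)).
  have -> : 2^-1 ^+ 2 = 1 / 4 :> R by field.
  by lra.
exists q => // w wq; have [wr Aw ew _] := qP _ wq; split => //.
  by have [] := jlt _ ew.
apply/eqP; rewrite -subr_eq0 -normr_le0.
by apply: (@le_geometric0 _ _ (K * `|w| ^+ 2)) => n; exact: close.
Qed.

End NormalCoordinates.

(** * Symmetric spaces *)

Lemma open_setI_preimage {T S : topologicalType} (A : set T) (B : set S) (f : T -> S) :
  open A -> open B -> (forall x, A x -> {for x, continuous f}) ->
  open (A `&` f @^-1` B).
Proof.
rewrite !openE => Ao Bo fc x [Ax Bfx]; apply: filterI; first exact: Ao.
exact: (fc _ Ax _ (Bo _ Bfx)).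
Qed.

Section SymmetricSpaces.
Context {R : realType}.

Lemma addl_continuous (E : normedModType R) (p : E) : continuous (+%R p).
Proof. by move=> x; apply: cvgD; [exact: cvg_cst | exact: cvg_id]. Qed.

Lemma is_diff_addl (E : normedModType R) (p x : E) : is_diff x (+%R p) id.
Proof.
apply: is_diff_dist => // [y|e e0]; first exact: cvg_id.
exists 1 => // y _; rewrite opprD addrACA subrr add0r subrr normr0.
by rewrite mulr_ge0// ltW.
Qed.

Lemma smooth_on_addl (E : normedModType R) (U : set E) (p : E) : open U ->
  smooth_on U (+%R p).
Proof.
move=> Uo; apply: smooth_on_add => //; first exact: smooth_on_cst.
exact: smooth_on_id.
Qed.

Variables (M : symmetricSpace R) (c : M).
Let phi := atlas M (chart_at c).
Let E := model (chart_at c).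
Let p : E := fwd phi c.

(** For a group with [x . y = x y^-1 x] and [c] the unit, [x . c] is the square of [x]; here it is
    read in the chart translated so that [c] becomes [0]. *)
Definition chart_square (v : E) : E := fwd phi (refl M (bwd phi (p + v)) c) - p.

Definition chart_square_dom : set E :=
  [set v | cod phi (p + v) /\ dom phi (refl M (bwd phi (p + v)) c)].

Lemma chart_square_doubling : doubling chart_square_dom chart_square.
Proof.
have [muc muS] := refl_smooth M.
have [cK cM cc] := @refl_space R M c.
have dc : dom phi c := mem_chart_at c.
have cp : cod phi p by exact: fwd_cod.
have bp : bwd phi p = c by rewrite /p fwdK.
pose f' (q : E * E) := refl M (bwd phi q.1) (bwd phi q.2).
pose O := (cod phi `*` cod phi) `&` f' @^-1` dom phi.
pose m := fwd phi \o f'.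
have mS : smooth_on O m by exact: (muS (chart_at c) (chart_at c) (chart_at c)).
have Oo : open O.
  apply: open_setI_preimage; [|exact: open_dom|].
    by apply: open_setX; exact: open_cod.
  move=> [v w] [/= cv cw].
  pose b (q : E * E) := (bwd phi q.1, bwd phi q.2).
  have bc : {for (v, w), continuous b}.
    apply: cvg_pair.
      apply: (@continuous_comp _ _ _ fst (bwd phi)); first exact: cvg_fst.
      exact: bwd_continuous.
    apply: (@continuous_comp _ _ _ snd (bwd phi)); first exact: cvg_snd.
    exact: bwd_continuous.
  exact: (continuous_comp bc (muc _)).
have Opp : O (p, p) by split => //=; rewrite /f' /= bp cc.
have mpp : m (p, p) = p by rewrite /m /f' /= bp cc.
have dm := smooth_on_differentiable mS Opp.
pose D := 'd m (p, p).
have pK x : p + (x - p) = x by rewrite addrC subrK.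
have add0 : p + 0 = p :> E by rewrite addr0.
(* The two partial maps and the diagonal are treated at once, as affine embeddings [i] through
   [(p, p)] with linear part [di]. *)
have slice (i : E -> E * E) (di : E -> E * E) :
    (forall v, is_diff v i di) -> i 0 = (p, p) -> smooth_on setT i ->
    let U := i @^-1` O in let s := fun v => m (i v) - p in
    [/\ open U, U 0, smooth_on U s, s 0 = 0 & forall h, 'd s 0 h = D (di h)].
  move=> idi i0 iS U s.
  have Uo : open U.
    apply: open_comp => // v _; exact: (smooth_on_continuous iS).
  have U0 : U 0 by rewrite /U /= i0.
  split => //.
  - apply: smooth_on_add => //; last exact: smooth_on_cst.
    by apply: (smooth_on_comp Uo Oo _ _ mS) => //; exact: smooth_on_sub iS.
  - by rewrite /s i0 mpp subrr.
  move=> h; have dm0 : is_diff (i 0) m D by rewrite i0; exact: differentiableP.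
  have ds := is_diff_comp (idi 0) dm0.
  have [_ sE] := is_diffB ds (is_diff_cst p (0 : E)).
  have -> : s = (m \o i) - cst p by [].
  by rewrite sE /= fctE /= subr0.
have addS : smooth_on [set: E] (+%R p) by apply: smooth_on_addl; exact: openT.
have cstS : smooth_on [set: E] (cst p) by exact: smooth_on_cst.
have [U1o U10 S1 s10 D1] := slice (fun v => (p + v, p)) (fun h => (h, 0))
  (fun v => is_diff_pair (is_diff_addl p v) (is_diff_cst p v))
  (congr1 (fun z => (z, p)) add0) (smooth_on_pair openT addS cstS).
have [U2o U20 S2 s20 D2] := slice (fun v => (p, p + v)) (fun h => (0, h))
  (fun v => is_diff_pair (is_diff_cst p v) (is_diff_addl p v))
  (congr1 (fun z => (p, z)) add0) (smooth_on_pair openT cstS addS).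
have [U3o U30 S3 s30 D3] := slice (fun v => (p + v, p + v)) (fun h => (h, h))
  (fun v => is_diff_pair (is_diff_addl p v) (is_diff_addl p v))
  (congr1 (fun z => (z, z)) add0) (smooth_on_pair openT addS addS).
have Ddiag h : D (h, h) = h.
  have [_ sE] : is_diff (0 : E) (fun v => m (p + v, p + v) - p) id.
    apply: (@is_diff_ext _ _ _ _ id _ id 0 U3o U30) => v [[/= cv _] _].
    have [_ _ vv] := @refl_space R M (bwd phi (p + v)).
    by rewrite /m /f' /= vv bwdK// addrC addKr.
  by rewrite -D3 sE.
have DN h : D (0, h) = - h.
  rewrite -D2.
  have [_ [V Vn VE]] := refl_isolated c.
  have [d d0 dV] : exists2 d : R, 0 < d &
      forall y, `|y - p| < d -> (cod phi `&` bwd phi @^-1` V) y.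
    apply/nbhs_distP; apply: filterI.
      by apply: open_nbhs_nbhs; split => //; exact: open_cod.
    by have := bwd_continuous cp; apply; rewrite bp.
  have [d' d'0 dU] := open_dist U2o U20.
  apply: (involution_isolated_diff (d := Num.min d d') U2o U20 S2 s20).
  - move=> w [[/= _ cw]]; rewrite /f' /= bp => dw.
    by rewrite /m /f' /= bp pK fwdK// cK bwdK// addrC addKr.
  - by rewrite lt_min d0.
  move=> w; rewrite lt_min => /andP[wd wd'].
  have [] := dV (p + w); first by rewrite addrC addKr.
  move=> cw Vw; have [] := dU w; first by rewrite subr0.
  move=> _; rewrite /f' /= bp => dw; rewrite /m /f' /= bp => we.
  have fixw : refl M c (bwd phi (p + w)) = bwd phi (p + w).
    by rewrite -{2}we pK fwdK.
  have : (V `&` [set y | refl M c y = y]) (bwd phi (p + w)) by [].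
  rewrite VE => /= /(congr1 (fwd phi)); rewrite bwdK// -/p.
  by move=> /eqP; rewrite -subr_eq0 addrC addKr => /eqP.
have -> : chart_square_dom = (fun v => (p + v, p)) @^-1` O.
  apply/seteqP; split => v; first by case=> cv dv; split; rewrite /f' /= ?bp.
  by case=> -[cv _]; rewrite /f' /= bp => dv; split.
have -> : chart_square = (fun v => m (p + v, p) - p).
  by apply/funext => v; rewrite /m /f' /= bp.
split; [exact: U1o | exact: U10 | exact: S1 | exact: s10 | move=> h; rewrite D1].
have -> : (h, 0) = (h, h) - (0, h) :> E * E by congr pair; rewrite /= ?subr0 ?subrr.
by rewrite linearB [X in X - _]Ddiag [X in _ - X]DN opprK scaler_nat mulr2n.
Qed.

End SymmetricSpaces.
Arguments chart_square {R M} c v.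
Arguments chart_square_dom {R M} c.

(** * The adapted chart *)

Section AdaptedChart.
Context {R : realType} {M : banachManifold R} (i : chart_index M).
Let phi := atlas M i.
Let E := model i.
Variables (p : E) (e : E -> E) (r r1 : R) (O : set M).
Let Br := [set v : E | `|v| < r].
Hypothesis r1r : r1 <= r.
Hypothesis eC : smooth_on Br e.
Hypothesis eid : forall v w, Br v -> Br w -> `|e v - e w - (v - w)| <= 2^-1 * `|v - w|.
Hypothesis Oo : open O.

Let Br1 := [set v : E | `|v| < r1].
Let sub1 : Br1 `<=` Br. Proof. by move=> v /= vr; exact: lt_le_trans r1r. Qed.
Let pK x : p + (x - p) = x. Proof. by rewrite addrC subrK. Qed.

(** In the application [O] confines the points of [N] in the domain to the part of [N] covered by
    its own normal coordinates, and [r1] confines the vectors in the image of [T_c i] to images of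
    short vectors. *)
Definition nc_chart_dom : set M :=
  (dom phi `&` O) `&` fwd phi @^-1` ((fun x => x - p) @^-1` (e @` Br1)).
Definition nc_chart_cod : set E :=
  (Br1 `&` (fun v => p + e v) @^-1` cod phi) `&` (bwd phi \o (fun v => p + e v)) @^-1` O.
Definition nc_chart_fwd (y : M) : E := near_id_inv e r (fwd phi y - p).
Definition nc_chart_bwd (v : E) : M := bwd phi (p + e v).

Let subp_continuous : continuous (fun x : E => x - p).
Proof. by move=> x; apply: cvgB; [exact: cvg_id | exact: cvg_cst]. Qed.

Let pe_continuous v : Br v -> {for v, continuous (fun v => p + e v)}.
Proof.
by move=> vr; apply: cvgD; [exact: cvg_cst | exact: (smooth_on_continuous eC)].
Qed.

Let Vo : open (e @` Br1).
Proof. by apply: (near_id_open eid) => //; exact: open_norm_lt. Qed.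

Let sub1V : e @` Br1 `<=` e @` Br.
Proof. by move=> _ [v /sub1 vr <-]; exists v. Qed.

Lemma nc_open_dom : open nc_chart_dom.
Proof.
apply: open_setI_preimage.
- by apply: openI => //; exact: open_dom.
- by apply: open_comp => // x _; exact: subp_continuous.
by move=> x [dx _]; exact: fwd_continuous.
Qed.

Lemma nc_open_cod : open nc_chart_cod.
Proof.
apply: open_setI_preimage => //.
  apply: open_setI_preimage; [exact: open_norm_lt | exact: open_cod |].
  by move=> v /sub1; exact: pe_continuous.
move=> v [/sub1 vr cv]; apply: continuous_comp; first exact: pe_continuous.
exact: bwd_continuous.
Qed.

Lemma nc_fwd_cod y : nc_chart_dom y -> nc_chart_cod (nc_chart_fwd y).
Proof.
move=> [[dy Oy] [v vr1 ev]].
have -> : nc_chart_fwd y = v by rewrite /nc_chart_fwd -ev near_idK//; exact: sub1.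
have pev : p + e v = fwd phi y by rewrite ev pK.
split; first by split => //; rewrite /= pev; exact: fwd_cod.
by rewrite /= pev fwdK.
Qed.

Lemma nc_bwd_dom v : nc_chart_cod v -> nc_chart_dom (nc_chart_bwd v).
Proof.
move=> [[vr cv] Ov]; split; first by split => //; exact: bwd_dom.
by exists v => //; rewrite /nc_chart_bwd bwdK// addrC addKr.
Qed.

Lemma nc_fwdK y : nc_chart_dom y -> nc_chart_bwd (nc_chart_fwd y) = y.
Proof.
move=> [[dy _] /sub1V yV]; rewrite /nc_chart_bwd /nc_chart_fwd.
by rewrite (near_id_invK yV) pK fwdK.
Qed.

Lemma nc_bwdK v : nc_chart_cod v -> nc_chart_fwd (nc_chart_bwd v) = v.
Proof.
move=> [[vr cv] _]; rewrite /nc_chart_fwd /nc_chart_bwd bwdK//.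
by rewrite [p + _]addrC addrK near_idK//; exact: sub1.
Qed.

Lemma nc_fwd_continuous y : nc_chart_dom y -> {for y, continuous nc_chart_fwd}.
Proof.
move=> [[dy _] /sub1V yV].
have c1 : {for y, continuous (fun y => fwd phi y - p)}.
  by apply: cvgB; [exact: fwd_continuous | exact: cvg_cst].
apply: (continuous_comp c1).
exact: (smooth_on_continuous (near_id_inv_smooth eC eid)).
Qed.

Lemma nc_bwd_continuous v : nc_chart_cod v -> {for v, continuous nc_chart_bwd}.
Proof.
move=> [[/sub1 vr cv] _]; apply: (continuous_comp (pe_continuous vr)).
exact: bwd_continuous.
Qed.

Definition nc_chart : chart M E :=
  Chart nc_open_dom nc_open_cod nc_fwd_cod nc_bwd_dom nc_fwdK nc_bwdK
    nc_fwd_continuous nc_bwd_continuous.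

Lemma nc_manifold_chart : manifold_chart nc_chart.
Proof.
have tr_open (F F' : completeNormedModType R) (a : chart M F) (b : chart M F') :
    open (cod a `&` bwd a @^-1` dom b).
  apply: open_setI_preimage; [exact: open_cod | exact: open_dom |].
  by move=> v; exact: bwd_continuous.
move=> k; split; rewrite /smooth_transition.
  set U := cod _ `&` _; have Uo : open U by exact: tr_open.
  suff : smooth_on U ((fwd (atlas M k) \o bwd phi) \o (fun v => p + e v)) by [].
  apply: (smooth_on_comp Uo (tr_open _ _ phi (atlas M k))).
  - by move=> v [[[_ cv] _] dv].
  - apply: smooth_on_add => //; first exact: smooth_on_cst.
    by apply: smooth_on_sub eC => v [[[/sub1]]].
  exact: atlas_compatible.
set U := cod _ `&` _; have Uo : open U by exact: tr_open.
have dU v : U v -> [/\ cod (atlas M k) v, dom phi (bwd (atlas M k) v) &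
    (e @` Br) (fwd phi (bwd (atlas M k) v) - p)].
  by move=> [cv [[dv _] /sub1V eV]].
suff : smooth_on U (near_id_inv e r \o
  (fun v => fwd phi (bwd (atlas M k) v) - p)) by [].
apply: (smooth_on_comp Uo (V := e @` Br)).
- by apply: (near_id_open eid) => //; exact: open_norm_lt.
- by move=> v /dU[].
- apply: smooth_on_add => //; last exact: smooth_on_cst.
  apply: smooth_on_sub (atlas_compatible k i).
  by move=> v /dU[].
exact: near_id_inv_smooth.
Qed.

End AdaptedChart.

Theorem corollary3p20 (R : realType) (M : symmetricSpace R) (N : set M)
    (S : integralSubspace N)
    (hS : topological_embedding (isub_incl S)) :
  symmetric_subspace N.
Proof.
split; first exact: isub_reflection S.
move=> y0; rewrite -{1}(isub_range S) => -[c _ <-{y0}].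
pose io := isub_incl S.
pose phi := atlas M (chart_at (io c)).
pose psi := atlas S (chart_at c).
pose p := fwd phi (io c); pose q := fwd psi c.
have dc : dom phi (io c) := mem_chart_at (io c).
have dc' : dom psi c := mem_chart_at c.
have cq : cod psi q by exact: fwd_cod.
have bq : bwd psi q = c by rewrite /q fwdK.
have [ioc ioS] := isub_smooth S.
have [eM [rM [CM [r0M nM]]]] :=
  doubling_normal_coordinates (chart_square_doubling (io c)).
have [eN [rN [CN [r0N nN]]]] := doubling_normal_coordinates (chart_square_doubling c).
pose W := (fun w => q + w) @^-1` (cod psi `&` (io \o bwd psi) @^-1` dom phi).
(* The inclusion in centred charts. As it respects the multiplications, it intertwines the two maps
   [chart_square]. *)
pose j w := fwd phi (io (bwd psi (q + w))) - p.
have W1o : open (cod psi `&` (io \o bwd psi) @^-1` dom phi).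
  apply: open_setI_preimage; [exact: open_cod | exact: open_dom |].
  by move=> v cv; apply: continuous_comp; [exact: bwd_continuous | exact: ioc].
have Wo : open W by apply: open_comp => // w _; exact: addl_continuous.
have W0 : W 0 by rewrite /W /= addr0 bq.
have jS : smooth_on W j.
  apply: smooth_on_add => //; last exact: smooth_on_cst.
  suff : smooth_on W ((fwd phi \o io \o bwd psi) \o +%R q) by [].
  by apply: (smooth_on_comp Wo W1o) => //; exact: smooth_on_addl.
have j0 : j 0 = 0 by rewrite /j addr0 bq subrr.
have dj : 'd j 0 = tangent_map io (x := c) :> (_ -> _).
  have d1 := is_diff_addl q (0 : model (chart_at c)).
  have d2 : differentiable (fwd phi \o io \o bwd psi) (q + 0).
    apply: (smooth_on_differentiable (ioS (chart_at c) (chart_at (io c)))).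
    by rewrite addr0; split => //=; rewrite bq.
  have [_ jE] := is_diffB (is_diff_comp d1 (differentiableP d2))
    (is_diff_cst p (0 : model (chart_at c))).
  have -> : j = ((fwd phi \o io \o bwd psi) \o +%R q) - cst p by [].
  by rewrite jE; apply/funext => h; rewrite fctE /= subr0 addr0.
have js w : chart_square_dom c w -> W w ->
    j (chart_square c w) = chart_square (io c) (j w).
  move=> [cw dw] [_ /= dw'].
  rewrite /j /chart_square -/phi -/psi -/p -/q.
  have -> : q + (fwd psi (refl S (bwd psi (q + w)) c) - q) =
            fwd psi (refl S (bwd psi (q + w)) c) by rewrite addrC subrK.
  have -> : p + (fwd phi (io (bwd psi (q + w))) - p) = fwd phi (io (bwd psi (q + w))).
    by rewrite addrC subrK.
  by rewrite !fwdK// /io isub_mul.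
have [ro ro0 nat] := normal_coordinates_natural nN nM Wo W0 jS j0 js.
have [[Ainj Aemb] Acl] := isub_tangent c.
rewrite -/io -dj in Ainj Aemb Acl.
(* The only use of the induced topology: the neighbourhood [ON] of [c] in [S] is
   the trace of an open set [OM] of [M]. *)
pose BN := [set w : model (chart_at c) | `|w| < ro].
have BNr : BN `<=` [set w | `|w| < rN] by move=> w /nat[].
have eBo : open (eN @` BN).
  by apply: (near_id_open (nc_near_id nN)) => //; exact: open_norm_lt.
pose ON := dom psi `&` fwd psi @^-1` ((fun x => x - q) @^-1` (eN @` BN)).
have ONo : open ON.
  apply: open_setI_preimage; first exact: open_dom.
    apply: open_comp => // x _; apply: cvgB; [exact: cvg_id | exact: cvg_cst].
  by move=> x; exact: fwd_continuous.
have [OM OMo OME] : exists2 B : set M, open B & io @^-1` B = ON by apply/hS.2.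
(* Since [T_c i] is a topological embedding, there will be [r2] such that [|'d j 0 w| < r2] forces
   [|w| < ro]. *)
have [B' B'o B'E] : exists2 B, open B & 'd j 0 @^-1` B = BN.
  by apply/Aemb; exact: open_norm_lt.
have B'0 : B' 0.
  have : ('d j 0 @^-1` B') 0 by rewrite B'E /BN /= normr0.
  by rewrite /= linear0.
have [r2 r20 r2B] := open_dist B'o B'0.
pose r1 := Num.min rM r2.
have r1M : r1 <= rM by rewrite ge_min lexx.
pose chi := nc_chart (i := chart_at (io c)) p r1M (nc_smooth nM) (nc_near_id nM) OMo.
pose F := range ('d j 0).
exists (model (chart_at (io c))), chi, F.
have eM0 := normal_coordinates0 nM.
have eN0 := normal_coordinates0 nN.
have dchi : dom chi (io c).
  split.
    split => //; suff : (io @^-1` OM) c by [].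
    rewrite OME; split => //=; rewrite subrr.
    by exists 0 => //; rewrite /BN /= normr0.
  by rewrite /= subrr; exists 0 => //=; rewrite normr0 lt_min (nc_radius nM).
split => //.
- exact: nc_manifold_chart.
- split => //.
  + by exists 0 => //; rewrite linear0.
  + by move=> _ _ [u _ <-] [v _ <-]; exists (u + v) => //; rewrite linearD.
  + by move=> a _ [u _ <-]; exists (a *: u) => //; rewrite linearZ.
have jE w : BN w -> [/\ `|'d j 0 w| < rM, cod psi (q + eN w),
    dom phi (io (bwd psi (q + eN w))) &
    fwd phi (io (bwd psi (q + eN w))) = p + eM ('d j 0 w)].
  move=> /nat[_ Aw [cw dw] jw]; split => //.
  by rewrite -jw /j [RHS]addrC subrK.
(* A point of [N] in the domain lies in [OM], so it is given by some [w] in [BN], and naturality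
   shows that its coordinate is ['d j 0 w]. Conversely, a coordinate ['d j 0 w] shorter than [r2]
   has [w] in [BN], and the same formula places its point in [N]. *)
apply/seteqP; split => [_ [y [dy Ny] <-]|v [cv [w _ wv]]].
  split; first exact: fwd_cod dy.
  move: Ny; rewrite -(isub_range S) => -[x _ xy]; rewrite -/io in xy.
  have [[dphi OMy] _] := dy.
  have : (io @^-1` OM) x by rewrite /= xy.
  rewrite OME => -[dx [w Bw ew]]; have [Aw cw dw fw] := jE w Bw.
  exists w => //; rewrite /chi /= /nc_chart_fwd -xy.
  have xE : x = bwd psi (q + eN w) by rewrite ew addrC subrK fwdK.
  by rewrite xE -/phi fw addrC addKr (near_idK (nc_near_id nM)).
have Bw : BN w.
  rewrite -B'E /= wv; apply: r2B; rewrite subr0.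
  by case: cv => -[/= + _] _; rewrite lt_min => /andP[].
have [Aw cw dw fw] := jE w Bw.
exists (bwd chi v); last exact: bwdK.
split; first exact: bwd_dom.
rewrite -(isub_range S) /= /nc_chart_bwd -wv -/phi -fw fwdK//.
by exists (bwd psi (q + eN w)).
Qed.
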